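(* For triangles $t_i,t_j$ on different rigid bodies let $$\mathcal{P}^{t_i\cup t_j}(x)=\min_{p=(n,d)\in\mathbb{R}^3\times\mathbb{R}}\Big[\tfrac{12}{(1-\|n\|)^+}+\sum_{k=1}^3\tfrac{1}{(\langle x_{i(k)},n\rangle+d)^+}+\sum_{k=1}^3\tfrac{1}{(\langle x_{j(k)},-n\rangle-d)^+}\Big],$$ and let $\mathcal{P}(x)=\sum_{t_i\neq t_j}\mathcal{P}^{t_i\cup t_j}(x)$, where the sum is over pairs of triangles on different rigid bodies. Then: (1) each $\mathcal{P}^{t_i\cup t_j}$ (with $\mathcal{I}=t_i$, $\mathcal{J}=t_j$) has the pairwise log-barrier property, has the pairwise smoothness property, and is non-prehensile; (2) consequently, $\mathcal{P}$ has the log-barrier property, the smoothness property, and the non-prehensile and non-vanishing property.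
   Context: Setting. There are $V$ vertices $x_1,\dots,x_V\in\mathbb{R}^3$, concatenated as $x\in\mathbb{R}^{3V}$, and finitely many triangles $t_i=\{i(1),i(2),i(3)\}\subset\{1,\dots,V\}$. The vertices are partitioned among finitely many rigid bodies and each triangle has all its vertices on one body. $\mathcal{C}\subset\mathbb{R}^{3V}$ is the set of configurations (each body moves rigidly on $\mathcal{C}$). $\mathrm{CH}$ denotes the closed convex hull; $\mathrm{CH}(x_{\mathcal{I}})=\mathrm{CH}(\{x_i:i\in\mathcal{I}\})$. $\mathcal{C}_{\rm obs}=\{x\in\mathcal{C}:\exists\, t_k\neq t_l \text{ on different rigid bodies with } \mathrm{CH}(x_{t_k})\cap\mathrm{CH}(x_{t_l})\neq\emptyset\}$ and $\mathcal{C}_{\rm free}=\mathcal{C}\setminus\mathcal{C}_{\rm obs}$. For disjoint index sets $\mathcal{I},\mathcal{J}$ of vertices of two different rigid bodies, $\mathcal{C}_{\rm obs}^{\mathcal{I}\cup\mathcal{J}}$ is defined in the same way but only using triangles with $t_k\cup t_l\subseteq\mathcal{I}\cup\mathcal{J}$, and $\mathcal{C}_{\rm free}^{\mathcal{I}\cup\mathcal{J}}=\mathcal{C}\setminus\mathcal{C}_{\rm obs}^{\mathcal{I}\cup\mathcal{J}}$. Notation. $1/(s)^+=1/\max(s,0)$, with value $+\infty$ for $s\le 0$. Potentials take values in the extended reals; the minimum is $+\infty$ if the objective is identically $+\infty$. Potentials are given by their formulas on $\mathbb{R}^{3V}$, and derivatives with respect to $x$ are taken in $\mathbb{R}^{3V}$.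 Pairwise properties. A potential $\mathcal{P}^{\mathcal{I}\cup\mathcal{J}}$, a function of $x_i$ ($i\in\mathcal{I}$) and $x_j$ ($j\in\mathcal{J}$): - has the pairwise log-barrier property if $\mathcal{P}^{\mathcal{I}\cup\mathcal{J}}(x)\ge 0$ for all $x\in\mathcal{C}$ and $\mathcal{P}^{\mathcal{I}\cup\mathcal{J}}(x)=\infty$ iff $x\in\mathcal{C}_{\rm obs}^{\mathcal{I}\cup\mathcal{J}}$; - has the pairwise smoothness property if it is twice differentiable at every $x\in\mathcal{C}_{\rm free}^{\mathcal{I}\cup\mathcal{J}}$; - is non-prehensile at $x$, where $\mathrm{CH}(x_{\mathcal{I}})\cap\mathrm{CH}(x_{\mathcal{J}})=\emptyset$, if $-\partial\mathcal{P}^{\mathcal{I}\cup\mathcal{J}}/\partial x_i\in\mathcal{F}_{\mathcal{J}\to\mathcal{I}}$ for all $i\in\mathcal{I}$ and $-\partial\mathcal{P}^{\mathcal{I}\cup\mathcal{J}}/\partial x_j\in\mathcal{F}_{\mathcal{I}\to\mathcal{J}}$ for all $j\in\mathcal{J}$, where $\mathcal{F}_{\mathcal{J}\to\mathcal{I}}=\{\alpha(a-b):\alpha>0,\ a\in\mathrm{CH}(x_{\mathcal{I}}),\ b\in\mathrm{CH}(x_{\mathcal{J}})\}$ (and $\mathcal{F}_{\mathcal{I}\to\mathcal{J}}$ symmetrically); it is non-prehensile if this holds at every $x\in\mathcal{C}$ with $\mathrm{CH}(x_{\mathcal{I}})\cap\mathrm{CH}(x_{\mathcal{J}})=\emptyset$.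 Properties of a total potential $\mathcal{P}$: - log-barrier: $\mathcal{P}\ge 0$ is continuous on $\mathcal{C}$ (as a $[0,\infty]$-valued function) and $\mathcal{P}(x)=\infty$ iff $x\in\mathcal{C}_{\rm obs}$; - smoothness: $\mathcal{P}$ is twice differentiable at every $x\in\mathcal{C}_{\rm free}$; - non-prehensile and non-vanishing: at every $x\in\mathcal{C}_{\rm free}$ there is a finite family $\mathcal{A}(x)$ of pairs $\langle\mathcal{I},\mathcal{J}\rangle$ with $\mathcal{I}\cap\mathcal{J}=\emptyset$, $\mathcal{I}\cup\mathcal{J}\subseteq\{1,\dots,V\}$, $\mathrm{CH}(x_{\mathcal{I}})\cap\mathrm{CH}(x_{\mathcal{J}})=\emptyset$, such that $\mathcal{P}=\sum_{\langle\mathcal{I},\mathcal{J}\rangle\in\mathcal{A}(x)}\mathcal{P}^{\mathcal{I}\cup\mathcal{J}}$ with every term non-prehensile at $x$, and for every pair of triangles $\langle t_i,t_j\rangle$ on different rigid bodies, $t_i\cup t_j\subseteq\mathcal{I}\cup\mathcal{J}$ for at least one $\langle\mathcal{I},\mathcal{J}\rangle\in\mathcal{A}(x)$. *)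

(* Defs.v *)
From HB Require Import structures.
From mathcomp Require Import all_boot all_order all_algebra.
From mathcomp Require Import all_classical all_reals all_analysis.

Set Implicit Arguments.
Unset Strict Implicit.
Unset Printing Implicit Defensive.

Import Order.TTheory GRing.Theory Num.Theory.
Import numFieldNormedType.Exports.

Local Open Scope classical_set_scope.
Local Open Scope ring_scope.

Section Geometry.
Context {R : realType}.

Definition dot n (u v : 'rV[R]_n) : R := \sum_(k < n) u 0 k * v 0 k.

(* The library norm on matrices is the max norm, hence this definition. *)
Definition enorm n (u : 'rV[R]_n) : R := Num.sqrt (dot u u).

Definition closed_convex_hull n (A : set 'rV[R]_n) : set 'rV[R]_n :=
  smallest (fun S : set 'rV[R]_n => closed S /\ convex_set S) A.

(* Row i of x : 'M[R]_(V, 3) is the vertex x_i; R^{3V} is 'M[R]_(V, 3). *)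
Definition CH V (x : 'M[R]_(V, 3)) (I : {set 'I_V}) : set 'rV[R]_3 :=
  closed_convex_hull [set row i x | i in [set` I]].

Definition force_cone V (x : 'M[R]_(V, 3)) (J I : {set 'I_V}) : set 'rV[R]_3 :=
  [set v | exists alpha a b,
     [/\ 0 < alpha, CH x I a, CH x J b & v = alpha *: (a - b)]].

End Geometry.

Section Potentials.
Context {R : realType} {V : nat}.
Implicit Types (P : 'M[R]_(V, 3) -> \bar R) (x : 'M[R]_(V, 3)).
Implicit Types (I J : {set 'I_V}) (C : set 'M[R]_(V, 3)).

Definition depends_only_on (S : {set 'I_V}) P :=
  forall x y, (forall i, i \in S -> row i x = row i y) -> P x = P y.

(* Derivatives of an extended-real-valued function are those of its real part
   [fine \o P]; every use below also asks that P be finite near the point. *)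
Definition real_part P : 'M[R]_(V, 3) -> R^o := fun x => fine (P x).

(* Row i is the derivative with respect to the vertex x_i. *)
Definition gradient P x : 'M[R]_(V, 3) :=
  \matrix_(i, k) 'D_(delta_mx i k) (real_part P) x.

Definition finite_near P x := \forall y \near x, P y \is a fin_num.

Definition twice_differentiable P x :=
  [/\ finite_near P x,
      \forall y \near x, differentiable (real_part P) y &
      differentiable (gradient P) x].

Definition nonprehensile_at I J P x :=
  [/\ finite_near P x,
      differentiable (real_part P) x,
      forall i, i \in I -> force_cone x J I (- row i (gradient P x)) &
      forall j, j \in J -> force_cone x I J (- row j (gradient P x))].

Definition pairwise_nonprehensile C I J P :=
  forall x, C x -> CH x I `&` CH x J = set0 -> nonprehensile_at I J P x.

End Potentials.

Section Scene.
Context {R : realType} {V T B : nat}.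
Variables (tri : 'I_T -> 'I_3 -> 'I_V) (body : 'I_V -> 'I_B).
Variable C : set 'M[R]_(V, 3).
Implicit Types (P : 'M[R]_(V, 3) -> \bar R).

(* C is any set of configurations along which each body undergoes only
   orientation-preserving rigid motions. *)
Definition moves_rigidly :=
  forall x y, C x -> C y -> forall b : 'I_B,
  exists (Q : 'M[R]_3) (c : 'rV[R]_3),
    [/\ Q *m Q^T = 1%:M, \det Q = 1 &
        forall i, body i = b -> row i y = row i x *m Q + c].

Definition vset (t : 'I_T) : {set 'I_V} := [set tri t k | k : 'I_3].

(* All vertices of a triangle lie on one body, so vertex 0 identifies it. *)
Definition tbody (t : 'I_T) : 'I_B := body (tri t ord0).

Definition C_obs : set 'M[R]_(V, 3) :=
  [set x | C x /\ exists k l, [/\ k != l, tbody k != tbody l &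
     CH x (vset k) `&` CH x (vset l) !=set0]].

Definition C_free : set 'M[R]_(V, 3) := C `\` C_obs.

Definition C_obs_on (S : {set 'I_V}) : set 'M[R]_(V, 3) :=
  [set x | C x /\ exists k l, [/\ k != l, tbody k != tbody l,
     vset k :|: vset l \subset S &
     CH x (vset k) `&` CH x (vset l) !=set0]].

Definition C_free_on (S : {set 'I_V}) : set 'M[R]_(V, 3) := C `\` C_obs_on S.

Definition pairwise_log_barrier (I J : {set 'I_V}) P :=
  (forall x, C x -> (0 <= P x)%E) /\
  (forall x, C x -> (P x = +oo%E <-> C_obs_on (I :|: J) x)).

Definition pairwise_smooth (I J : {set 'I_V}) P :=
  forall x, C_free_on (I :|: J) x -> twice_differentiable P x.

Definition log_barrier P :=
  [/\ forall x, C x -> (0 <= P x)%E,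
      {within C, continuous P} &
      forall x, C x -> (P x = +oo%E <-> C_obs x)].

Definition smooth P := forall x, C_free x -> twice_differentiable P x.

(* The pairwise potentials P^{I \cup J} available for the decomposition are the
   members Q k of a family, attached to the pairs <I k, J k>; A(x) is a set of
   indices into this family. *)
Definition nonprehensile_nonvanishing (K : finType) (I J : K -> {set 'I_V})
    (Q : K -> 'M[R]_(V, 3) -> \bar R) P :=
  forall x, C_free x -> exists A : {set K},
    [/\ forall k, k \in A ->
          [/\ I k :&: J k = finset.set0,
              CH x (I k) `&` CH x (J k) = set0,
              depends_only_on (I k :|: J k) (Q k) &
              nonprehensile_at (I k) (J k) (Q k) x],
        forall y, P y = (\sum_(k in A) Q k y)%E &
        forall i j, tbody i != tbody j ->
          exists2 k, k \in A & vset i :|: vset j \subset I k :|: J k].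

(* 1 / (s)^+; the library's inverse on extended reals maps 0 to +oo. *)
Definition inv_pos (s : R) : \bar R := (((Num.max s 0)%:E)^-1)%E.

Definition pair_objective (i j : 'I_T) (x : 'M[R]_(V, 3))
    (p : 'rV[R]_3 * R) : \bar R :=
  let: (n, d) := p in
  (12%:E * inv_pos (1 - enorm n)
   + \sum_(k < 3) inv_pos (dot (row (tri i k) x) n + d)
   + \sum_(k < 3) inv_pos (dot (row (tri j k) x) (- n) - d))%E.

(* Attainment of this infimum is asserted separately, see [is_minimum]. *)
Definition pair_potential (i j : 'I_T) (x : 'M[R]_(V, 3)) : \bar R :=
  ereal_inf (range (pair_objective i j x)).

(* Unordered pairs: each pair of triangles is counted once. *)
Definition total_potential (x : 'M[R]_(V, 3)) : \bar R :=
  (\sum_(p : 'I_T * 'I_T | (p.1 < p.2)%N && (tbody p.1 != tbody p.2))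
     pair_potential p.1 p.2 x)%E.

End Scene.

Definition is_minimum {R : realType} {U : Type} (f : U -> \bar R) (m : \bar R) :=
  (exists p, f p = m) /\ (forall p, (m <= f p)%E).

(* Main.v *)
(* For fixed [x] the objective is finite exactly at the planes [(n, d)] with
   [|n| < 1] that strictly separate the two triangles.  There it is a sum of
   inverses of slacks, and the identity
     1/s' - 1/s = - (s' - s)/s^2 + (s' - s)^2/(s^2 s')
   shows that it exceeds each of its linearizations by a multiple of the squared
   distance.  This quadratic growth makes the minimizing plane continuous in [x]
   and the Hessian in [(n, d)] injective, so by the implicit function theorem the
   minimizing plane is differentiable.  By the envelope theorem the gradient of
   the minimal value with respect to a vertex is then the gradient of the
   objective at the optimal plane, a multiple of [n] that is again
   differentiable.  Stationarity in [d] and [n] exhibits [n] as a positive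
   multiple of a difference of convex combinations of the vertices of the two
   triangles, which is the non-prehensile property. *)

From HB Require Import structures.
Require Import Defs.
From mathcomp Require Import all_boot all_order all_algebra.
From mathcomp Require Import all_classical all_reals all_analysis.
From mathcomp Require Import ring lra.

Set Implicit Arguments.
Unset Strict Implicit.
Unset Printing Implicit Defensive.

Import Order.TTheory GRing.Theory Num.Theory.
Import numFieldNormedType.Exports.

Local Open Scope classical_set_scope.
Local Open Scope ring_scope.

(** * The Euclidean inner product *)

(** No Hessian is computed. The quadratic growth is an inequality between two feasible planes that
    involves first derivatives only, and it yields both the continuity of the optimal plane and the
    injectivity of the second derivative. The obstacle is that the norm term controls [n] but not
    [d]; growth in [d] comes from the slack of a single vertex, which is bounded above because there
    is a vertex on each side of the plane. The same two vertices exclude [n = 0], where the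
    Euclidean norm is not differentiable. The second tool is a stability estimate whose constants
    depend only on a bound for the barrier: a plane of bounded value stays feasible, at nearly the
    same value, when the configuration moves a little. It carries the optimal planes of neighbouring
    configurations back to [x], and it makes the potential tend to infinity at a configuration
    without feasible plane. *)

Section Dot.
Context {R : realType} {n : nat}.
Implicit Types (u v w : 'rV[R]_n) (a : R).

Lemma dotC u v : dot u v = dot v u.
Proof. by apply: eq_bigr => k _; rewrite mulrC. Qed.

Lemma dotDl u v w : dot (u + v) w = dot u w + dot v w.
Proof. by rewrite -big_split; apply: eq_bigr => k _; rewrite mxE mulrDl. Qed.

Lemma dotZl a u v : dot (a *: u) v = a * dot u v.
Proof. by rewrite mulr_sumr; apply: eq_bigr => k _; rewrite mxE mulrA. Qed.

Lemma dotNl u v : dot (- u) v = - dot u v.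
Proof. by rewrite -scaleN1r dotZl mulN1r. Qed.

Lemma dotBl u v w : dot (u - v) w = dot u w - dot v w.
Proof. by rewrite dotDl dotNl. Qed.

Lemma dotDr u v w : dot w (u + v) = dot w u + dot w v.
Proof. by rewrite dotC dotDl !(dotC w). Qed.

Lemma dotZr a u v : dot u (a *: v) = a * dot u v.
Proof. by rewrite dotC dotZl dotC. Qed.

Lemma dotNr u v : dot u (- v) = - dot u v.
Proof. by rewrite dotC dotNl dotC. Qed.

Lemma dotBr u v w : dot w (u - v) = dot w u - dot w v.
Proof. by rewrite dotDr dotNr. Qed.

Lemma dot0l u : dot 0 u = 0.
Proof. by rewrite -(scale0r u) dotZl mul0r. Qed.

Lemma dot0r u : dot u 0 = 0.
Proof. by rewrite dotC dot0l. Qed.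

Lemma dot_suml (I : Type) (r : seq I) (P : pred I) (F : I -> 'rV[R]_n) u :
  dot (\sum_(i <- r | P i) F i) u = \sum_(i <- r | P i) dot (F i) u.
Proof.
by elim/big_rec2: _ => [|i x y _ <-]; [exact: dot0l | rewrite dotDl].
Qed.

Lemma sqr_coord_le_dot u k : u 0 k ^+ 2 <= dot u u.
Proof.
rewrite /dot (bigD1 k)//= -expr2 lerDl; apply: sumr_ge0 => i _.
by rewrite -expr2 sqr_ge0.
Qed.

Lemma dot_ge0 u : 0 <= dot u u.
Proof. by apply: sumr_ge0 => i _; rewrite -expr2 sqr_ge0. Qed.

Lemma dot_eq0 u : (dot u u == 0) = (u == 0).
Proof.
apply/eqP/eqP => [u0|->]; last exact: dot0l.
apply/rowP => k; rewrite mxE; apply/eqP; rewrite -sqrf_eq0 eq_le sqr_ge0 andbT.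
by rewrite -u0 sqr_coord_le_dot.
Qed.

Lemma dot_gt0 u : (0 < dot u u) = (u != 0).
Proof. by rewrite lt_def dot_eq0 dot_ge0 andbT. Qed.

Lemma enorm_ge0 u : 0 <= enorm u. Proof. exact: sqrtr_ge0. Qed.

Lemma sqr_enorm u : enorm u ^+ 2 = dot u u.
Proof. exact/sqr_sqrtr/dot_ge0. Qed.

Lemma enorm_eq0 u : (enorm u == 0) = (u == 0).
Proof. by rewrite -sqrf_eq0 sqr_enorm dot_eq0. Qed.

Lemma enorm_gt0 u : (0 < enorm u) = (u != 0).
Proof. by rewrite lt_def enorm_eq0 enorm_ge0 andbT. Qed.

Lemma enorm0 : enorm (0 : 'rV[R]_n) = 0.
Proof. by apply/eqP; rewrite enorm_eq0. Qed.

Lemma enormZ a u : enorm (a *: u) = `|a| * enorm u.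
Proof. by rewrite /enorm dotZl dotZr mulrA -expr2 sqrtrM ?sqr_ge0// sqrtr_sqr. Qed.

Lemma dot_le_enorm u v : dot u v <= enorm u * enorm v.
Proof.
have [->|u0] := eqVneq u 0; first by rewrite dot0l enorm0 mul0r.
have [->|v0] := eqVneq v 0; first by rewrite dot0r enorm0 mulr0.
move: u0 v0; rewrite -!enorm_gt0 => u0 v0.
have := dot_ge0 (enorm v *: u - enorm u *: v).
rewrite !(dotBl, dotBr, dotZl, dotZr) -!sqr_enorm (dotC v u) => h.
have {}h : 0 <= (enorm u * enorm v) * (enorm u * enorm v - dot u v) by nra.
by rewrite -subr_ge0 -(pmulr_rge0 _ (mulr_gt0 u0 v0)).
Qed.

Lemma normr_coord_le (u : 'rV[R]_n) k : `|u 0 k| <= `|u|.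
Proof.
rewrite [leRHS]/Num.Def.normr/= mx_normrE.
exact: (le_bigmax _ (fun ij => `|u ij.1 ij.2|) (0, k)).
Qed.

Lemma normr_le_enorm u : `|u| <= enorm u.
Proof.
rewrite [leLHS]/Num.Def.normr/= mx_normrE.
apply: bigmax_le => [|[i k] _]; first exact: enorm_ge0.
by rewrite ord1/= -sqrtr_sqr ler_wsqrtr// sqr_coord_le_dot.
Qed.

Lemma enorm_coord_le u k : `|u 0 k| <= enorm u.
Proof. exact: le_trans (normr_coord_le u k) (normr_le_enorm u). Qed.

(** The two norms are mixed on purpose: differentiability is measured in the max norm, whereas
    normals of feasible planes are bounded in the Euclidean norm. *)
Lemma normr_dot_le u v : `|dot u v| <= n%:R * `|u| * enorm v.
Proof.
rewrite (le_trans (ler_norm_sum _ _ _))//.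
rewrite -mulrA -[n in n%:R]card_ord -sum1_card natr_sum mulr_suml.
apply: ler_sum => k _; rewrite mul1r normrM ler_pM//.
- exact: normr_coord_le.
- exact: enorm_coord_le.
Qed.

End Dot.

Lemma normr_row_le {R : realType} {V m : nat} (i : 'I_V) (x : 'M[R]_(V, m)) :
  `|row i x| <= `|x|.
Proof.
rewrite [leLHS]/Num.Def.normr/= mx_normrE.
apply: bigmax_le => // -[j k] _; rewrite mxE/= [leRHS]/Num.Def.normr/= mx_normrE.
exact: (le_bigmax _ (fun ij => `|x ij.1 ij.2|) (i, k)).
Qed.

Lemma dot_hsplit {R : realType} {m p : nat} (u v : 'rV[R]_(m + p)) :
  dot u v = dot (lsubmx u) (lsubmx v) + dot (rsubmx u) (rsubmx v).
Proof.
by rewrite /dot big_split_ord; congr (_ + _); apply: eq_bigr => k _; rewrite !mxE.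
Qed.

Lemma sqr_dot_le {R : realType} {n : nat} (u v : 'rV[R]_n) :
  dot u v ^+ 2 <= dot u u * dot v v.
Proof.
have := dot_le_enorm u v; have := dot_le_enorm (- u) v.
rewrite -!sqr_enorm /enorm !dotNl dotNr opprK -/(enorm u) -/(enorm v).
rewrite -exprMn => h1 h2; rewrite -ler_sqrt ?sqr_ge0//.
by rewrite !sqrtr_sqr ler_norml (ger0_norm (mulr_ge0 (enorm_ge0 _) (enorm_ge0 _))) lerNl h1.
Qed.

Lemma dot_inj {R : realType} {n : nat} (u v : 'rV[R]_n) :
  (forall w, dot u w = dot v w) -> u = v.
Proof.
by move=> h; apply/eqP; rewrite -subr_eq0 -dot_eq0 dotBl h subrr.
Qed.

(** * Differential calculus *)

Lemma near_addl {R : realType} {U : normedModType R} (x : U) (P : set U) :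
  (\near x, P x) -> \forall h \near (0 : U), P (h + x).
Proof. by move/nbhs0P; apply: filterS => h; rewrite addrC. Qed.

Section Frechet.
Context {R : realType} {U W : normedModType R}.
Implicit Types (f : U -> W) (x : U).

Lemma is_diff_of_bound f (L : {linear U -> W}) x : continuous L ->
  (forall e, 0 < e -> \forall h \near (0 : U), `|f (h + x) - f x - L h| <= e * `|h|) ->
  is_diff x f L.
Proof.
move=> cL fL.
have fo : f \o shift x = cst (f x) + L +o_ 0 id.
  apply/eqaddoP => _/posnumP[e]; apply: filterS (fL e%:num _) => //= h.
  by rewrite !fctE/= opprD addrA.
have dfL := diff_unique cL fo.
by apply: DiffDef => //; apply/diff_locallyP; rewrite dfL; split.
Qed.

Lemma diff_bound f x : differentiable f x -> forall e, 0 < e ->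
  \forall h \near (0 : U), `|f (h + x) - f x - 'd f x h| <= e * `|h|.
Proof.
move=> /diff_locallyP[_ /eqaddoP df] e e0; apply: filterS (df e e0) => /= h.
by rewrite !fctE/= opprD addrA.
Qed.

End Frechet.

Lemma near_eq_is_diff {R : realType} {U W : normedModType R} (f g : U -> W) (x : U) :
  (\forall y \near x, f y = g y) -> differentiable f x -> is_diff x g ('d f x).
Proof.
move=> fg df; apply: is_diff_of_bound; first exact: diff_continuous.
move=> e e0; apply: filterS2 (diff_bound df e0) (near_addl fg) => h.
by move=> + E; rewrite E (nbhs_singleton fg).
Qed.

(** The sum is compared with [s] only near [x] because [fine] is known to be additive only where the
    potentials are finite. *)
Lemma near_eq_diffD {R : realType} {U W : normedModType R} (f g s : U -> W) (x : U) :
  (\forall y \near x, f y + g y = s y) -> differentiable f x -> differentiable g x ->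
  differentiable s x /\ forall u, 'D_u f x + 'D_u g x = 'D_u s x.
Proof.
move=> E df dg; have dfg : differentiable (f + g) x by exact: differentiableD.
have [ds dE] := near_eq_is_diff E dfg; split=> // u.
by rewrite (deriveE _ ds) dE -(deriveE _ dfg) deriveD//; exact: diff_derivable.
Qed.

Lemma near_dist_le {R : realType} {U : normedModType R} (x : U) (d : R) :
  0 < d -> \forall y \near x, `|x - y| <= d.
Proof. by move=> d0; apply/nbhs_normP; exists d => // y /= /ltW. Qed.

Section BigDiff.
Context {R : realType} {U W : normedModType R} {I : finType}.

Lemma differentiable_bigsum (f : I -> U -> W) (z : U) :
  (forall i, differentiable (f i) z) -> differentiable (fun y => \sum_i f i y) z.
Proof.
move=> df; have -> : (fun y => \sum_i f i y) = \sum_i f i.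
  by apply/funext => y; rewrite fct_sumE.
by elim/big_rec : _ => [|i g _ dg]; [exact: differentiable_cst | exact: differentiableD].
Qed.

Lemma is_derive_bigsum (f : I -> U -> W) (z w : U) (df : I -> W) :
  (forall i, is_derive z w (f i) (df i)) ->
  is_derive z w (fun y => \sum_i f i y) (\sum_i df i).
Proof.
move=> hf; have -> : (fun y => \sum_i f i y) = \sum_i f i.
  by apply/funext => y; rewrite fct_sumE.
by elim/big_rec2 : _ => [|i g y _ dg]; [exact: is_derive_cst | exact: is_deriveD].
Qed.

End BigDiff.

Section LinearDiff.
Context {R : realType} {U W : normedModType R} (f : U -> W).
Hypotheses (lin : linear f) (cont : continuous f).

Lemma differentiable_of_linear z : differentiable f z.
Proof.
pose L : {linear U -> W} := HB.pack f (GRing.isLinear.Build _ _ _ _ _ lin).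
exact: (linear_differentiable (f := L)).
Qed.

Lemma is_derive_of_linear z u : is_derive z u f (f u).
Proof.
pose L : {linear U -> W} := HB.pack f (GRing.isLinear.Build _ _ _ _ _ lin).
have dL := differentiable_of_linear z.
apply: DeriveDef; first exact: diff_derivable.
by rewrite deriveE// (diff_lin (f := L)).
Qed.

End LinearDiff.

Lemma differentiable_matrix {R : realType} {U : normedModType R} {p q : nat}
    (f : U -> 'M[R]_(p, q)) (z : U) :
  (forall i j, differentiable (fun y => f y i j) z) -> differentiable f z.
Proof.
move=> df.
have -> : f = (fun y => \sum_i \sum_j f y i j *: delta_mx i j).
  by apply/funext => y; exact: matrix_sum_delta.
by do 2 (apply: differentiable_bigsum => ?); exact: differentiableZl.
Qed.

Lemma continuous_enorm {R : realType} {n : nat} : continuous (@enorm R n).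
Proof.
move=> u; apply: (@continuous_comp _ _ _ (fun u => dot u u) Num.sqrt); last exact: sqrt_continuous.
apply: differentiable_continuous; apply: differentiable_bigsum => i.
by apply: differentiableM; exact: differentiable_coord.
Qed.

Lemma diff_local_min {R : realType} {U : normedModType R} (f : U -> R) (z : U) :
  differentiable f z -> (\forall y \near z, f z <= f y) -> forall u, 'd f z u = 0.
Proof.
move=> df fz.
suff ge0 u : 0 <= 'd f z u.
  move=> u; apply/eqP; rewrite eq_le ge0 andbT.
  by rewrite -oppr_ge0 -linearN.
rewrite leNgt; apply/negP => du.
have u0 : u != 0 by apply: contraTN du => /eqP ->; rewrite linear0 ltxx.
have nu : 0 < `|u| by rewrite normr_gt0.
(* With this [eps] the error along [k *: u] is at most half of the first-order decrease, so the
   value would drop below the minimum. *)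
pose eps := - 'd f z u / (2 * `|u|).
have e0 : 0 < eps by rewrite divr_gt0 ?oppr_gt0 ?mulr_gt0.
have hk : \forall k \near (0 : R),
    `|f (k *: u + z) - f z - 'd f z (k *: u)| <= eps * `|k *: u| /\
    f z <= f (k *: u + z).
  apply: filterI.
    exact: (@near0Z _ _ u (fun h => `|f (h + z) - f z - 'd f z h| <= eps * `|h|) (diff_bound df e0)).
  exact: (@near0Z _ _ u (fun h => f z <= f (h + z)) (near_addl fz)).
have /nbhs_normP[r /= r0 hr] := hk.
pose k := r / 2; have k0 : 0 < k by rewrite divr_gt0.
have [] : `|f (k *: u + z) - f z - 'd f z (k *: u)| <= eps * `|k *: u| /\
    f z <= f (k *: u + z).
  by apply: hr; rewrite /= sub0r normrN gtr0_norm// /k; lra.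
have -> : 'd f z (k *: u) = k * 'd f z u by rewrite linearZ.
rewrite normrZ (gtr0_norm k0) => /ler_normlP[_] + h.
have -> : eps * (k * `|u|) = - (k * 'd f z u) / 2.
  by rewrite /eps; field; rewrite gt_eqF.
have : k * 'd f z u < 0 by rewrite pmulr_rlt0.
lra.
Qed.

(** * Differentiability of implicit functions *)

Section Implicit.
Context {R : realType}.

Lemma linear_continuous_of_bound (U W : normedModType R) (L : {linear U -> W}) (c : R) :
  (forall u, `|L u| <= c * `|u|) -> continuous L.
Proof.
move=> Lc; apply: bounded_linear_continuous.
apply/linear_boundedP; near=> r => u; apply: le_trans (Lc u) _.
by rewrite ler_wpM2r.
Unshelve. all: by end_near. Qed.

Lemma normr_mulmx_le p q (v : 'rV[R]_p) (A : 'M[R]_(p, q)) :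
  `|v *m A| <= p%:R * `|A| * `|v|.
Proof.
rewrite [leLHS]/Num.Def.normr/= mx_normrE; apply: bigmax_le => [|[i k] _].
  by rewrite !mulr_ge0.
rewrite mxE (le_trans (ler_norm_sum _ _ _))//.
rewrite -mulrA -[p in p%:R]card_ord -sum1_card natr_sum mulr_suml.
apply: ler_sum => j _; rewrite mul1r normrM mulrC ler_pM//.
- rewrite [leRHS]/Num.Def.normr/= mx_normrE.
  exact: (le_bigmax _ (fun ij => `|A ij.1 ij.2|) (j, k)).
- by rewrite ord1; exact: normr_coord_le.
Qed.

(* Only the differentiability half of the implicit function theorem: the
   implicit function [g] is given and already known to be continuous. *)
Lemma implicit_differentiable (U : normedModType R) (p : nat)
    (F : U * 'rV[R]_p -> 'rV[R]_p) (g : U -> 'rV[R]_p) (x : U) :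
  differentiable F (x, g x) -> {for x, continuous g} ->
  (\forall y \near x, F (y, g y) = 0) ->
  (forall v, 'd F (x, g x) (0, v) = 0 -> v = 0) ->
  differentiable g x.
Proof.
move=> dF cg F0 inj.
pose D := 'd F (x, g x).
have Dadd u v : D (u, v) = D (u, 0) + D (0, v).
  by rewrite -linearD; congr (D _); apply/pair_equal_spec; rewrite addr0 add0r.
have lin2 : linear (fun v : 'rV[R]_p => D (0, v)).
  move=> a u v; rewrite -linearP; congr (D _).
  by apply/pair_equal_spec; rewrite /= scaler0 addr0.
pose D2 : {linear 'rV[R]_p -> 'rV[R]_p} :=
  HB.pack (fun v : 'rV[R]_p => D (0, v)) (GRing.isLinear.Build _ _ _ _ _ lin2).
pose A := lin1_mx D2.
have AE v : v *m A = D (0, v) by rewrite mul_rV_lin1.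
have uA : A \in unitmx.
  rewrite -row_free_unit; apply: inj_row_free => v; rewrite AE; exact: inj.
pose B := invmx A.
(* Differentiating [F (y, g y) = 0] forces [D (h, L h) = 0] for the derivative [L] of [g]; solving
   with [A] gives this formula. *)
have linL : linear (fun h : U => - D (h, 0) *m B).
  move=> a u v; rewrite scalemxAl -mulmxDl; congr (_ *m _).
  rewrite scalerN -opprD -linearP; congr (- D _).
  by apply/pair_equal_spec; rewrite /= scaler0 addr0.
pose L : {linear U -> 'rV[R]_p} :=
  HB.pack (fun h : U => - D (h, 0) *m B) (GRing.isLinear.Build _ _ _ _ _ linL).
have [k k0 Dk] : exists2 k, k > 0 & forall u, `|D u| <= k * `|u|.
  exact: linear_lipschitz (diff_continuous dF).
pose b := p%:R * `|B| + 1.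
have b0 : 0 < b by rewrite ltr_wpDl// mulr_ge0.
have Bb (v : 'rV[R]_p) : `|v *m B| <= b * `|v|.
  by apply: le_trans (normr_mulmx_le _ _) _; rewrite ler_wpM2r// lerDl.
have norm_pair (u : U) (v : 'rV[R]_p) : `|(u, v)| = Num.max `|u| `|v| by [].
have Lk h : `|L h| <= b * k * `|h|.
  apply: le_trans (Bb _) _; rewrite -mulrA ler_pM2l// normrN.
  apply: le_trans (Dk _) _.
  by rewrite ler_pM2l// norm_pair normr0 max_l.
suff H : is_diff x g L by exact: ex_diff.
apply: is_diff_of_bound.
  exact: linear_continuous_of_bound Lk.
move=> e e0.
(* The first bound gives [b * e1 <= 1/2], which lets |d| be absorbed into the left side, whence |d|
   <= (2bk + 1)|h|. The second then turns the error b e1 (|h| + |d|) into at most e |h|. *)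
pose e1 := Num.min ((2 * b)^-1) (e / (b * (2 * (b * k) + 2))).
have c0 : 0 < 2 * (b * k) + 2 by rewrite ltr_wpDl// mulr_ge0// mulr_ge0// ltW.
have e10 : 0 < e1 by rewrite lt_min invr_gt0 mulr_gt0//= divr_gt0// mulr_gt0.
have Fx := nbhs_singleton F0.
have {}F0 : \forall h \near (0 : U), F (h + x, g (h + x)) = 0.
  exact: near_addl F0.
have /nbhs_normP[r /= r0 hr] := diff_bound dF e10.
have {}cg : \forall h \near (0 : U), `|g (h + x) - g x| < r.
  have /cvgrPdist_lt/(_ r r0)/near_addl := cg.
  by apply: filterS => h /=; rewrite distrC.
have nr : \forall h \near (0 : U), `|h| < r
  by apply/nbhs_normP; exists r => // h; rewrite /= sub0r normrN.
move: F0 cg nr; apply: filterS3 => h Fh gr hr'.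
set d := g (h + x) - g x in gr *.
have : `|F ((h, d) + (x, g x)) - F (x, g x) - D (h, d)| <= e1 * `|(h, d)|.
  by apply: hr; rewrite /= sub0r normrN norm_pair gt_max hr'.
have -> : ((h, d) + (x, g x) = (h + x, g (h + x)) :> U * 'rV[R]_p).
  by congr pair; rewrite /d subrK.
rewrite Fh Fx subrr sub0r normrN norm_pair => Dhd.
have dL : d - L h = D (h, d) *m B.
  rewrite Dadd -AE mulmxDl /B mulmxK// addrC; congr (_ + _).
  by rewrite /L/= mulNmx opprK.
have {}Dhd : `|d - L h| <= b * (e1 * (`|h| + `|d|)).
  rewrite dL; apply: le_trans (Bb _) _; rewrite ler_pM2l//.
  apply: le_trans Dhd _; rewrite ler_pM2l// ge_max lerDl lerDr !normr_ge0//.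
have be1 : b * e1 <= 2^-1.
  by rewrite -ler_pdivlMl// -invfM mulrC ge_min lexx.
have be2 : b * e1 * (2 * (b * k) + 2) <= e.
  rewrite mulrAC mulrC -ler_pdivlMr ?mulr_gt0//.
  by rewrite ge_min lexx orbT.
have dd : `|d| <= b * k * `|h| + b * e1 * (`|h| + `|d|).
  rewrite -[d in X in X <= _](subrK (L h)) (le_trans (ler_normD _ _))// addrC lerD//.
  by rewrite -mulrA.
have dd2 : `|d| <= (2 * (b * k) + 1) * `|h|.
  have : b * e1 * (`|h| + `|d|) <= 2^-1 * (`|h| + `|d|) by rewrite ler_wpM2r// addr_ge0.
  by move=> ?; lra.
apply: (le_trans Dhd); rewrite mulrA.
apply: (@le_trans _ _ (b * e1 * ((2 * (b * k) + 2) * `|h|))).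
  rewrite ler_wpM2l//; first by rewrite mulr_ge0 ?ltW.
  by lra.
by rewrite mulrA ler_wpM2r.
Qed.
End Implicit.

(** * The barrier of a family of signed points *)

(** With r = |n|, s = |n'| and p = <n, n'>, one has |n' - n|^2 = (s - r)^2 + 2(rs - p). The radial
    part is paid by the remainder of 1/(1 - r), the transverse part rs - p by the convexity of the
    norm itself; both come with denominators at most 1. *)
Lemma norm_barrier_convex {R : realType} {m : nat} (n n' : 'rV[R]_m) : n != 0 -> enorm n < 1 -> enorm n' < 1 ->
  dot n (n' - n) / (enorm n * (1 - enorm n) ^+ 2) + 2^-1 * dot (n' - n) (n' - n)
    <= (1 - enorm n')^-1 - (1 - enorm n)^-1.
Proof.
rewrite -enorm_gt0.
have := dot_le_enorm n n'; have := enorm_ge0 n'.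
rewrite !(dotBl, dotBr) -!sqr_enorm (dotC n').
move: (enorm n) (enorm n') (dot n n') => r s p s0 prs r0 r1 s1.
have r1' : 0 < 1 - r by lra.
have s1' : 0 < 1 - s by lra.
have key : r ^+ 2 + s ^+ 2 - 2 * p = (s - r) ^+ 2 + 2 * (r * s - p) by ring.
have -> : (1 - s)^-1 - (1 - r)^-1 =
    (s - r) / (1 - r) ^+ 2 + (s - r) ^+ 2 / ((1 - r) ^+ 2 * (1 - s)).
  by field; rewrite !gt_eqF.
have -> : (s - r) / (1 - r) ^+ 2 =
    (p - r ^+ 2) / (r * (1 - r) ^+ 2) + (r * s - p) / (r * (1 - r) ^+ 2).
  by field; rewrite !gt_eqF.
have t0 : 0 < (1 - r) ^+ 2 by rewrite exprn_gt0.
have t1 : (1 - r) ^+ 2 <= 1 by rewrite exprn_ile1//; lra.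
have d1 : 0 < r * (1 - r) ^+ 2 <= 1.
  by rewrite mulr_gt0//= mulr_ile1 // ltW.
have d2 : 0 < (1 - r) ^+ 2 * (1 - s) <= 1.
  by rewrite mulr_gt0//= mulr_ile1 ?(ltW t0) ?(ltW s1')//; lra.
have h (a d : R) : 0 < d <= 1 -> 0 <= a -> a <= a / d.
  by move=> /andP[d0 d1'] a0; rewrite ler_pdivlMr// ler_piMr.
have h1 := h _ _ d2 (sqr_ge0 (s - r)).
have /(h _ _ d1) h2 : 0 <= r * s - p by rewrite subr_ge0.
have := sqr_ge0 (s - r); lra.
Qed.

Lemma inv_convex {R : realFieldType} (s s' : R) : 0 < s -> 0 < s' ->
  s'^-1 - s^-1 = - (s' - s) / s ^+ 2 + (s' - s) ^+ 2 / (s ^+ 2 * s').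
Proof. by move=> s0 s0'; field; rewrite !gt_eqF. Qed.

Section Barrier.
Context {R : realType} {V m : nat} {K : finType}.
Variables (v : K -> 'I_V) (e : K -> R).
Implicit Types (x h : 'M[R]_(V, m)) (q w : 'rV[R]_(m + 1)).

(* A plane (n, d) is encoded as the row [q] with [lsubmx q = n] and [rsubmx q = d];
   the sign [e k] = 1 or -1 tells on which side of it the vertex [v k] has to be. *)
Definition slack (k : K) x q : R :=
  e k * (dot (row (v k) x) (lsubmx q) + rsubmx q 0 0).

Definition barrier x q : R :=
  12 / (1 - enorm (lsubmx q)) + \sum_k (slack k x q)^-1.

Definition feasible x q := enorm (lsubmx q) < 1 /\ forall k, 0 < slack k x q.

(** Derivative of [barrier x] at [q] in the direction [w]. As [slack] is linear in the plane,
    [slack k x w] is its own directional derivative. *)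
Definition dbarrier x q w : R :=
  12 * dot (lsubmx q) (lsubmx w) / (enorm (lsubmx q) * (1 - enorm (lsubmx q)) ^+ 2)
  - \sum_k slack k x w / slack k x q ^+ 2.

Lemma slackD k x q w : slack k x (q + w) = slack k x q + slack k x w.
Proof. by rewrite /slack !linearD/= dotDr !mxE; ring. Qed.

Lemma slackZ k x a q : slack k x (a *: q) = a * slack k x q.
Proof. by rewrite /slack !linearZ/= dotZr !mxE; ring. Qed.

Lemma slackB k x q w : slack k x (q - w) = slack k x q - slack k x w.
Proof. by rewrite -scaleN1r slackD slackZ mulN1r. Qed.

Lemma dbarrierD x q w w' : dbarrier x q (w + w') = dbarrier x q w + dbarrier x q w'.
Proof.
rewrite /dbarrier linearD/= dotDr.
under eq_bigr do rewrite slackD mulrDl.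
by rewrite big_split/=; ring.
Qed.

Lemma dbarrierZ x q a w : dbarrier x q (a *: w) = a * dbarrier x q w.
Proof.
rewrite /dbarrier linearZ/= dotZr mulrBr; congr (_ - _); first by ring.
by rewrite [RHS]mulr_sumr; apply: eq_bigr => k _; rewrite slackZ -mulrA.
Qed.

(** The expansions of the single terms are added; 6 is the weight 12 times the factor 1/2 of
    [norm_barrier_convex]. *)
Lemma barrier_convex x q q' : lsubmx q != 0 -> feasible x q -> feasible x q' ->
  dbarrier x q (q' - q) + 6 * dot (lsubmx (q' - q)) (lsubmx (q' - q))
   + \sum_k slack k x (q' - q) ^+ 2 / (slack k x q ^+ 2 * slack k x q')
  <= barrier x q' - barrier x q.
Proof.
move=> n0 [n1 s0] [n1' s0'].
have := norm_barrier_convex n0 n1 n1'.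
rewrite /barrier opprD addrACA -sumrB /dbarrier linearB/=.
under [\sum_k (_ - _)]eq_bigr => k _ do
  rewrite inv_convex// -slackB mulNr.
rewrite big_split/= sumrN => h.
set S1 := \sum_k _; set S2 := \sum_k _ .
set A := dot _ _ in h *; set B := dot _ _ in h *.
lra.
Qed.

End Barrier.

(** * Quadratic growth in the plane *)

Section Growth.
Context {R : realType} {V m : nat} {K : finType}.
Variables (v : K -> 'I_V) (e : K -> R).
Implicit Types (x h : 'M[R]_(V, m)) (q w : 'rV[R]_(m + 1)).
Variables (k0 k1 : K) (ek0 : e k0 = 1) (ek1 : e k1 = -1).

Lemma slack_add_opp x q : slack v e k0 x q + slack v e k1 x q =
  dot (row (v k0) x - row (v k1) x) (lsubmx q).
Proof. by rewrite /slack ek0 ek1 dotBl; ring. Qed.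

(** Adding two slacks of opposite sign cancels [d] and leaves an inner product with the normal,
    which has to be positive. *)
Lemma feasible_normal_neq0 x q : feasible v e x q -> lsubmx q != 0.
Proof.
move=> [_ s0]; apply/eqP => n0.
have := addr_gt0 (s0 k0) (s0 k1); rewrite slack_add_opp n0 dot0r ltxx//.
Qed.

Lemma slack_le x q : feasible v e x q ->
  slack v e k0 x q <= enorm (row (v k0) x - row (v k1) x).
Proof.
move=> [n1 s0]; apply: (@le_trans _ _ (slack v e k0 x q + slack v e k1 x q)).
  by rewrite lerDl ltW.
rewrite slack_add_opp (le_trans (dot_le_enorm _ _))// ler_piMr ?enorm_ge0//.
exact: ltW.
Qed.

Lemma barrier_growth x : exists2 c, 0 < c & forall q q',
  feasible v e x q -> feasible v e x q' ->
  c * dot (q' - q) (q' - q) <=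
    barrier v e x q' - barrier v e x q - dbarrier v e x q (q' - q).
Proof.
pose X := dot (row (v k0) x) (row (v k0) x).
pose C := enorm (row (v k0) x - row (v k1) x) + 1.
have C0 : 0 < C by rewrite ltr_wpDl ?enorm_ge0.
have X0 : 0 <= X := dot_ge0 _.
have C3 : 0 < C ^+ 3 by rewrite exprn_gt0.
(* Below, |w|^2 <= A + 2 t^2 + 2 X A and t^2 <= C^3 S, so |w|^2 <= (1 + 2X + 2C^3)(6A + S). The
   summand 1 in [C] keeps it positive even if the two vertices coincide. *)
exists (1 + 2 * X + 2 * C ^+ 3)^-1; first by rewrite invr_gt0; lra.
move=> q q' fq fq'.
have := barrier_convex (feasible_normal_neq0 fq) fq fq'.
set w := q' - q; set D := dbarrier _ _ _ _ _; set S := \sum_k _.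
set B := barrier _ _ _ _ - _; set A := dot (lsubmx w) _ => hB.
have A0 : 0 <= A := dot_ge0 _.
have ww : dot w w = A + rsubmx w 0 0 ^+ 2.
  by rewrite dot_hsplit -/A; congr (_ + _); rewrite /dot big_ord1 expr2.
pose t := slack v e k0 x w.
have tE : t = dot (row (v k0) x) (lsubmx w) + rsubmx w 0 0 by rewrite /t /slack ek0 mul1r.
(* One summand of the remainder suffices: its denominator has three slack factors of [k0], each at
   most [C]. *)
have St : t ^+ 2 / C ^+ 3 <= S.
  rewrite /S (bigD1 k0)//= -/t ler_wpDr//.
    apply: sumr_ge0 => k _; rewrite divr_ge0 ?sqr_ge0// mulr_ge0 ?sqr_ge0//.
    by rewrite ltW//; apply fq'.2.
  have s1 := fq.2 k0; have s1' := fq'.2 k0.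
  have ss := mulr_gt0 (exprn_gt0 2 s1) s1'.
  rewrite ler_wpM2l ?sqr_ge0// lef_pV2 ?posrE//.
  rewrite (exprSr C 2) ler_pM ?sqr_ge0 ?(ltW s1')//.
    by rewrite lerXn2r ?nnegrE ?ltW// (le_lt_trans (slack_le fq))// /C ltrDl.
  by rewrite (le_trans (slack_le fq'))// /C lerDl.
have dX := sqr_dot_le (row (v k0) x) (lsubmx w); rewrite -/X -/A in dX.
rewrite mulrC ler_pdivrMr; last lra.
have S0 : t ^+ 2 <= C ^+ 3 * S by rewrite mulrC -ler_pdivrMr.
(* The change of [d] is b = t - a with a^2 <= X A, and 2 (a + b)^2 + 2 a^2 - b^2 is the square of b
   + 2a. *)
have w2 : rsubmx w 0 0 ^+ 2 <= 2 * t ^+ 2 + 2 * (X * A).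
  move: dX; rewrite tE; set a := dot _ _; set b := rsubmx _ _ _ => dX.
  have := sqr_ge0 (b + 2 * a); nra.
have BD : 6 * A + S <= B - D by lra.
have Sge : 0 <= S by rewrite (le_trans _ St)// divr_ge0 ?sqr_ge0// ltW.
rewrite ww.
have : (6 * A + S) * (1 + 2 * X + 2 * C ^+ 3) <= (B - D) * (1 + 2 * X + 2 * C ^+ 3).
  by rewrite ler_wpM2r//; lra.
apply: le_trans.
have : 0 <= A * X by rewrite mulr_ge0.
have : 0 <= A * C ^+ 3 by rewrite mulr_ge0// ltW.
have : 0 <= S * X by rewrite mulr_ge0.
nra.
Qed.

End Growth.

(** * Derivatives in the configuration and the plane jointly *)

Section BarrierDiff.
Context {R : realType} {V m : nat} {K : finType}.
Variables (v : K -> 'I_V) (e : K -> R).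
Local Notation X := 'M[R]_(V, m).
Local Notation Q := 'rV[R]_(m + 1).
Implicit Types (x h : X) (q w : Q) (z u : X * Q).

Let coord1_linear i j : linear (fun y : X * Q => y.1 i j : R^o).
Proof. by move=> a y z; rewrite /= !mxE. Qed.

Let coord1_continuous i j : continuous (fun y : X * Q => y.1 i j : R^o).
Proof.
move=> y; apply: (@continuous_comp _ _ _ fst (fun M : X => M i j)).
  exact: cvg_fst.
exact: coord_continuous.
Qed.

Let coord2_linear j : linear (fun y : X * Q => y.2 0 j : R^o).
Proof. by move=> a y z; rewrite /= !mxE. Qed.

Let coord2_continuous j : continuous (fun y : X * Q => y.2 0 j : R^o).
Proof.
move=> y; apply: (@continuous_comp _ _ _ snd (fun M : Q => M 0 j)).
  exact: cvg_snd.
exact: coord_continuous.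
Qed.

Let slackE k : (fun y : X * Q => slack v e k y.1 y.2) =
  (fun y => e k *: (\sum_(j < m) (y.1 (v k) j * y.2 0 (lshift 1 j)) + y.2 0 (rshift m 0))).
Proof.
apply/funext => y; rewrite /slack /dot; congr (_ * (_ + _)); last by rewrite !mxE.
by apply: eq_bigr => j _; rewrite !mxE.
Qed.

Lemma differentiable_slack k z : differentiable (fun y : X * Q => slack v e k y.1 y.2) z.
Proof.
rewrite slackE; apply: differentiableZ; apply: differentiableD.
  apply: differentiable_bigsum => j; apply: differentiableM.
    exact: differentiable_of_linear.
  exact: differentiable_of_linear.
exact: differentiable_of_linear.
Qed.

Lemma is_derive_slack k z u : is_derive z u (fun y : X * Q => slack v e k y.1 y.2)
  (slack v e k z.1 u.2 + e k * dot (row (v k) u.1) (lsubmx z.2)).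
Proof.
rewrite slackE; apply: is_derive_eq.
  apply: is_deriveZ; apply: is_deriveD.
    apply: is_derive_bigsum => j; apply: is_deriveM.
      exact: is_derive_of_linear.
    exact: is_derive_of_linear.
  exact: is_derive_of_linear.
rewrite /slack -mulrDr; congr (_ * _); rewrite /dot addrAC big_split/= mxE; congr (_ + _ + _).
by apply: eq_bigr => j _; rewrite !mxE.
by apply: eq_bigr => j _; rewrite !mxE mulrC.
Qed.

Let dotE : (fun y : X * Q => dot (lsubmx y.2) (lsubmx y.2)) =
  (fun y => \sum_(j < m) (y.2 0 (lshift 1 j) * y.2 0 (lshift 1 j))).
Proof. by apply/funext => y; apply: eq_bigr => j _; rewrite !mxE. Qed.

Let differentiable_dot z : differentiable (fun y : X * Q => dot (lsubmx y.2) (lsubmx y.2)) z.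
Proof.
rewrite dotE; apply: differentiable_bigsum => j; apply: differentiableM;
exact: differentiable_of_linear.
Qed.

Let is_derive_dot z u : is_derive z u
  (fun y : X * Q => dot (lsubmx y.2) (lsubmx y.2)) (2 * dot (lsubmx z.2) (lsubmx u.2)).
Proof.
rewrite dotE; apply: is_derive_eq.
  by apply: is_derive_bigsum => j; apply: is_deriveM; exact: is_derive_of_linear.
rewrite mulr_sumr; apply: eq_bigr => j _; rewrite !mxE.
by rewrite -[LHS]/(_ * _ + _ * _); ring.
Qed.

Lemma differentiable_enorm z : lsubmx z.2 != 0 ->
  differentiable (fun y : X * Q => enorm (lsubmx y.2)) z.
Proof.
move=> n0; apply: (@differentiable_comp _ _ _ _
  (fun y : X * Q => dot (lsubmx y.2) (lsubmx y.2)) Num.sqrt) => //.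
apply/derivable1_diffP; have := is_derive1_sqrt (K := R); rewrite -dot_gt0 in n0.
by move=> /(_ _ n0) [].
Qed.

Lemma is_derive_enorm z u : lsubmx z.2 != 0 ->
  is_derive z u (fun y : X * Q => enorm (lsubmx y.2))
    (dot (lsubmx z.2) (lsubmx u.2) / enorm (lsubmx z.2)).
Proof.
move=> n0; have dr := differentiable_enorm n0.
have der := diff_derivable (v := u) dr.
apply: DeriveDef => //.
have [_] := is_derive_dot z u.
(* The product rule for the squared norm determines the derivative [d] of the norm through 2 r d = 2
   <n, w>. *)
have -> : (fun y : X * Q => dot (lsubmx y.2) (lsubmx y.2)) =
    (fun y : X * Q => enorm (lsubmx y.2)) * (fun y : X * Q => enorm (lsubmx y.2)).
  by apply/funext => y; rewrite -sqr_enorm expr2.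
rewrite deriveM//; set r := enorm _; set d := 'D_u _ _ => h.
have r0 : r != 0 by rewrite enorm_eq0.
have {}h : r * d + r * d = 2 * dot (lsubmx z.2) (lsubmx u.2) by [].
have -> : dot (lsubmx z.2) (lsubmx u.2) = r * d by lra.
by rewrite mulrC mulKf.
Qed.

Lemma differentiable_barrier z : lsubmx z.2 != 0 -> feasible v e z.1 z.2 ->
  differentiable (fun y : X * Q => barrier v e y.1 y.2) z.
Proof.
move=> n0 [n1 s0]; apply: differentiableD.
  apply: differentiableZ; apply: differentiableV; last by rewrite subr_eq0 gt_eqF.
  by apply: differentiableB => //; exact: differentiable_enorm.
apply: differentiable_bigsum => k; apply: differentiableV; first exact: differentiable_slack.
by rewrite gt_eqF.
Qed.

(** The first term is the variation of the plane, the sum that of the vertices; the latter is what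
    [force] collects vertex by vertex. *)
Lemma is_derive_barrier z u : lsubmx z.2 != 0 -> feasible v e z.1 z.2 ->
  is_derive z u (fun y : X * Q => barrier v e y.1 y.2)
   (dbarrier v e z.1 z.2 u.2 -
    \sum_k e k * dot (row (v k) u.1) (lsubmx z.2) / slack v e k z.1 z.2 ^+ 2).
Proof.
move=> n0 [n1 s0].
have r0 : enorm (lsubmx z.2) != 0 by rewrite enorm_eq0.
have r1 : 1 - enorm (lsubmx z.2) != 0 by rewrite subr_eq0 gt_eqF.
have isV (f : X * Q -> R) df : f z != 0 -> is_derive z u f df ->
    is_derive z u (fun y => (f y)^-1) (- (f z) ^- 2 * df).
  by move=> f0 [fd <-]; split; [exact: derivableV | rewrite deriveV].
apply: is_derive_eq.
  apply: is_deriveD.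
    apply: is_deriveZ; apply: isV => //.
    by apply: is_deriveB; exact: is_derive_enorm.
  apply: is_derive_bigsum => k; apply: isV; first by rewrite gt_eqF.
  exact: is_derive_slack.
rewrite /dbarrier -addrA; congr (_ + _).
  rewrite -[LHS]/(12 * (- (1 - enorm (lsubmx z.2)) ^- 2 *
    (0 - dot (lsubmx z.2) (lsubmx u.2) / enorm (lsubmx z.2)))).
  by field; rewrite r0 r1.
rewrite -!sumrN -big_split/=; apply: eq_bigr => k _.
by ring.
Qed.

Lemma differentiable_dbarrier z w : lsubmx z.2 != 0 -> feasible v e z.1 z.2 ->
  differentiable (fun y : X * Q => dbarrier v e y.1 y.2 w) z.
Proof.
move=> n0 [n1 s0].
have r0 : enorm (lsubmx z.2) != 0 by rewrite enorm_eq0.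
have r1 : 1 - enorm (lsubmx z.2) != 0 by rewrite subr_eq0 gt_eqF.
have dX2 (f : X * Q -> R) : differentiable f z -> differentiable (fun y => f y ^+ 2) z.
  by move=> df; exact: differentiableM.
have dn : differentiable (fun y : X * Q => enorm (lsubmx y.2)) z by exact: differentiable_enorm.
apply: differentiableB; first apply: differentiableM.
- apply: differentiableZ.
  apply: differentiable_bigsum => j; apply: differentiableM => //.
  have -> : (fun y : X * Q => lsubmx y.2 0 j) = (fun y => y.2 0 (lshift 1 j)).
    by apply/funext => y; rewrite !mxE.
  exact: differentiable_of_linear.
- apply: differentiableV; last by rewrite mulf_neq0// expf_neq0.
  apply: differentiableM => //.
  by apply: dX2; apply: differentiableB.
- apply: differentiable_bigsum => k; apply: differentiableM.
  + have -> : (fun y : X * Q => slack v e k y.1 w) =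
      (fun y => e k *: (\sum_(j < m) (y.1 (v k) j * lsubmx w 0 j) + rsubmx w 0 0)).
      apply/funext => y; rewrite /slack; congr (_ * (_ + _)).
      by apply: eq_bigr => j _; rewrite mxE.
    apply: differentiableZ; apply: differentiableD => //.
    apply: differentiable_bigsum => j; apply: differentiableM => //.
    exact: differentiable_of_linear.
  + apply: differentiableV; last by rewrite expf_neq0// gt_eqF.
    by apply: dX2; exact: differentiable_slack.
Qed.

End BarrierDiff.

(** * Stability under perturbation of the configuration *)

Section Minimizer.
Context {R : realType} {V m : nat} {K : finType}.
Variables (v : K -> 'I_V) (e : K -> R).
Local Notation X := 'M[R]_(V, m).
Local Notation Q := 'rV[R]_(m + 1).
Implicit Types (x h : X) (q w : Q) (z u : X * Q).
Local Notation slack := (slack v e).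
Local Notation barrier := (barrier v e).
Local Notation feasible := (feasible v e).
Local Notation dbarrier := (dbarrier v e).

Lemma near_feasible z : feasible z.1 z.2 -> \forall y \near z, feasible y.1 y.2.
Proof.
move=> [n1 s0].
have h1 : \forall y \near z, enorm (lsubmx y.2) < 1.
  have c : {for z, continuous (fun y : X * Q => enorm (lsubmx y.2))}.
    apply: (@continuous_comp _ _ _ (fun y : X * Q => lsubmx y.2) (@enorm R m)); last exact: continuous_enorm.
    apply: (@continuous_comp _ _ _ snd lsubmx); first exact: cvg_snd.
    exact: continuous_lsubmx.
  exact: (cvgr_lt _ c).
have h2 : \forall y \near z, forall k, 0 < slack k y.1 y.2.
  apply: (@filter_forall _ K (fun k (y : X * Q) => 0 < slack k y.1 y.2) _ (nbhs_filter z)) => k.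
  exact: (cvgr_gt _ (differentiable_continuous (differentiable_slack v e k z))).
by apply: filterS2 h1 h2.
Qed.

Lemma near_feasible2 x q : feasible x q -> \forall w \near q, feasible x w.
Proof.
move=> f; have c : {for q, continuous (fun w : Q => (x, w))}.
  by apply: differentiable_continuous; exact: differentiable_pair.
exact: (c _ (near_feasible (z := (x, q)) f)).
Qed.

Lemma near_feasible1 x q : feasible x q -> \forall y \near x, feasible y q.
Proof.
move=> f; have c : {for x, continuous (fun y : X => (y, q))}.
  by apply: differentiable_continuous; exact: differentiable_pair.
exact: (c _ (near_feasible (z := (x, q)) f)).
Qed.

(** All terms are positive at a feasible plane, so a bound on the total keeps every slack away from
    zero. *)
Lemma slack_inv_le x q k : feasible x q -> (slack k x q)^-1 <= barrier x q.
Proof.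
move=> [n1 s0]; rewrite /barrier (bigD1 k)//= addrCA lerDl addr_ge0//.
  by rewrite divr_ge0// subr_ge0 ltW.
by apply: sumr_ge0 => i _; rewrite invr_ge0 ltW.
Qed.

Lemma enorm_inv_le x q : feasible x q -> 12 / (1 - enorm (lsubmx q)) <= barrier x q.
Proof.
by move=> [n1 s0]; rewrite lerDl; apply: sumr_ge0 => i _; rewrite invr_ge0 ltW.
Qed.

Lemma barrier_gt0 x q : feasible x q -> 0 < barrier x q.
Proof.
move=> f; apply: lt_le_trans (enorm_inv_le f).
by rewrite divr_gt0// subr_gt0; case: f.
Qed.

Hypothesis e1 : forall k, `|e k| = 1.

Lemma slack_lipschitz k x x' q : feasible x q ->
  `|slack k x' q - slack k x q| <= m%:R * `|x' - x|.
Proof.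
move=> [n1 _]; rewrite /slack -mulrBr normrM e1 mul1r opprD addrACA subrr addr0.
rewrite -dotBl -linearB/= (le_trans (normr_dot_le _ _))//.
rewrite -[leRHS]mulr1 ler_pM ?mulr_ge0 ?enorm_ge0//; last exact: ltW.
by rewrite ler_wpM2l// normr_row_le.
Qed.

(** The constants are chosen before [x] and [q], so the estimate applies to the unknown optimal
    plane of a neighbouring configuration. A value at most [M] makes every slack at least 1/M, and a
    small displacement at most halves that bound. *)
Lemma barrier_stable M : 0 < M -> exists d C, [/\ 0 < d, 0 <= C &
  forall x x' q, feasible x q -> barrier x q <= M -> `|x' - x| <= d ->
    feasible x' q /\ barrier x' q <= barrier x q + C * `|x' - x|].
Proof.
move=> M0; pose a : R := m%:R + 1.
have a0 : 0 < a by rewrite ltr_wpDl.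
(* Slacks move by at most a |x' - x|, hence by at most 1/(2M) within the first radius. Each
   reciprocal then changes by at most a |x' - x| times M times 2M. *)
exists (2 * a * M)^-1, (#|K|%:R * (2 * a * M ^+ 2)); split.
- by rewrite invr_gt0 !mulr_gt0.
- by rewrite mulr_ge0// mulr_ge0 ?sqr_ge0// mulr_ge0// ltW.
move=> x x' q f fM xd.
have sl k : M^-1 <= slack k x q.
  by rewrite -[leRHS]invrK lef_pV2 ?posrE ?invr_gt0 ?f.2// (le_trans (slack_inv_le k f)).
have sd k : `|slack k x' q - slack k x q| <= a * `|x' - x|.
  by rewrite (le_trans (slack_lipschitz _ _ f))// ler_wpM2r// lerDl.
have ad : a * `|x' - x| <= (2 * M)^-1.
  have := ler_wpM2l (ltW a0) xd; congr (_ <= _).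
  by field; rewrite !gt_eqF.
have M2 : (2 * M)^-1 = M^-1 / 2 by field; rewrite gt_eqF.
have sl' k : (2 * M)^-1 <= slack k x' q.
  have := sl k; have /ler_normlP[] := sd k; rewrite M2 in ad *; lra.
have M20 : 0 < (2 * M)^-1 by rewrite invr_gt0 mulr_gt0.
split; first by split; [exact: f.1 | move=> k; exact: lt_le_trans M20 (sl' k)].
have cE (y : R) : #|K|%:R * y = \sum_(k : K) y by rewrite sumr_const mulr_natl.
rewrite /barrier -addrA lerD2l -(mulrA #|K|%:R) cE.
rewrite -big_split/=; apply: ler_sum => k _; rewrite -lerBlDl.
have s0 := f.2 k; have s0' := lt_le_trans M20 (sl' k).
have -> : (slack k x' q)^-1 - (slack k x q)^-1 =
    (slack k x q - slack k x' q) * ((slack k x q)^-1 * (slack k x' q)^-1).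
  by field; rewrite !gt_eqF.
have i1 : (slack k x q)^-1 <= M by rewrite -[leRHS]invrK lef_pV2 ?posrE ?invr_gt0.
have i2 : (slack k x' q)^-1 <= 2 * M.
  by rewrite -[leRHS]invrK lef_pV2 ?posrE.
apply: (@le_trans _ _ (a * `|x' - x| * ((slack k x q)^-1 * (slack k x' q)^-1))).
  rewrite ler_wpM2r ?mulr_ge0 ?invr_ge0 ?(ltW s0) ?(ltW s0')//.
  by rewrite (le_trans _ (sd k))// distrC ler_norm.
apply: (@le_trans _ _ (a * `|x' - x| * (M * (2 * M)))); last by nra.
rewrite ler_wpM2l ?mulr_ge0 ?(ltW a0)//.
by rewrite ler_pM ?invr_ge0 ?(ltW s0) ?(ltW s0').
Qed.

End Minimizer.

(** * Existence and regularity of the minimizing plane *)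

Section Selection.
Context {R : realType} {V m : nat} {K : finType}.
Variables (v : K -> 'I_V) (e : K -> R).
Local Notation X := 'M[R]_(V, m).
Local Notation Q := 'rV[R]_(m + 1).
Implicit Types (x h : X) (q w : Q) (z u : X * Q).
Local Notation slack := (slack v e).
Local Notation barrier := (barrier v e).
Local Notation feasible := (feasible v e).
Local Notation dbarrier := (dbarrier v e).
Hypothesis e1 : forall k, `|e k| = 1.
Variables (k0 k1 : K).
Hypotheses (ek0 : e k0 = 1) (ek1 : e k1 = -1).

Definition minimizes x q :=
  feasible x q /\ forall q', feasible x q' -> barrier x q <= barrier x q'.

Lemma barrier_continuous2 x q : feasible x q -> {for q, continuous (barrier x)}.
Proof.
move=> f; apply: (@continuous_comp _ _ _ (fun w : Q => (x, w)) (fun y : X * Q => barrier y.1 y.2)).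
  by apply: differentiable_continuous; exact: differentiable_pair.
apply: differentiable_continuous; apply: differentiable_barrier => //.
exact: (feasible_normal_neq0 ek0 ek1 f).
Qed.

Lemma barrier_continuous1 x q : feasible x q -> {for x, continuous (fun y => barrier y q)}.
Proof.
move=> f; apply: (@continuous_comp _ _ _ (fun y : X => (y, q)) (fun y : X * Q => barrier y.1 y.2)).
  by apply: differentiable_continuous; exact: differentiable_pair.
apply: differentiable_continuous; apply: differentiable_barrier => //.
exact: (feasible_normal_neq0 ek0 ek1 f).
Qed.

Lemma slack_continuous2 k x : continuous (slack k x).
Proof.
move=> q; apply: (@continuous_comp _ _ _ (fun w : Q => (x, w)) (fun y : X * Q => slack k y.1 y.2)).
  by apply: differentiable_continuous; exact: differentiable_pair.
by apply: differentiable_continuous; exact: differentiable_slack.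
Qed.

Lemma feasible_minimizes x q0 : feasible x q0 -> exists q, minimizes x q.
Proof.
move=> f0; pose M := barrier x q0; have M0 : 0 < M := barrier_gt0 f0.
(* A closed set that contains every feasible plane of value at most [M] and consists of feasible
   planes, so that [barrier x] is continuous on it. *)
pose S := [set q | enorm (lsubmx q) <= 1 - 12 / M /\ forall k, M^-1 <= slack k x q].
have Sf q : S q -> feasible x q.
  move=> [nq sq]; split; last by move=> k; rewrite (lt_le_trans _ (sq k))// invr_gt0.
  by rewrite (le_lt_trans nq)// ltrBlDr ltrDl divr_gt0.
have fS q : feasible x q -> barrier x q <= M -> S q.
  move=> fq qM; split.
    have := enorm_inv_le fq; have := fq.1; rewrite -subr_gt0 => r1 h.
    rewrite lerBrDr -lerBrDl ler_pdivrMr// mulrC -ler_pdivrMr//.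
    exact: le_trans h qM.
  move=> k; have s0 := fq.2 k; rewrite -[leRHS]invrK lef_pV2 ?posrE ?invr_gt0//.
  exact: le_trans (slack_inv_le k fq) qM.
have Scl : closed S.
  have -> : S = [set q | enorm (lsubmx q) <= 1 - 12 / M] `&`
      \bigcap_k [set q | M^-1 <= slack k x q].
    by apply/seteqP; split=> q [? h]; split=> // k; [move=> _|]; exact: h.
  apply: closedI.
    apply: (@closed_comp _ _ (fun q : Q => enorm (lsubmx q)) [set r | r <= 1 - 12 / M]).
      move=> q _; apply: (@continuous_comp _ _ _ lsubmx (@enorm R m)).
        exact: continuous_lsubmx.
      exact: continuous_enorm.
    exact: closed_le.
  apply: closed_bigI => k _.
  apply: (@closed_comp _ _ (slack k x) [set r | M^-1 <= r]).
    by move=> q _; exact: slack_continuous2.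
  exact: closed_ge.
(* The coordinate [d] is the slack of [k0] minus an inner product: the former is bounded by the
   first summand, the latter by the second. The summand 1 covers the normal. *)
pose C := enorm (row (v k0) x - row (v k1) x) + enorm (row (v k0) x) + 1.
have Sb q : S q -> `|q| <= C.
  move=> /Sf fq; have := slack_le ek0 ek1 fq; have s0 := fq.2 k0.
  have := dot_le_enorm (row (v k0) x) (lsubmx q).
  have := dot_le_enorm (- row (v k0) x) (lsubmx q).
  have : enorm (row (v k0) x) * enorm (lsubmx q) <= enorm (row (v k0) x).
    by rewrite ler_piMr ?enorm_ge0// ltW// fq.1.
  have -> : enorm (- row (v k0) x) = enorm (row (v k0) x).
    by rewrite -scaleN1r enormZ normrN1 mul1r.
  move: s0; rewrite /slack ek0 mul1r dotNl => s0 h1 h2 h3 h4.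
  have c0 := enorm_ge0 (row (v k0) x - row (v k1) x).
  have c1 := enorm_ge0 (row (v k0) x).
  rewrite [leLHS]/Num.Def.normr/= mx_normrE; apply: bigmax_le => [|[i j] _].
    by rewrite /C !addr_ge0.
  rewrite ord1/=; case: (split_ordP j) => l ->.
    have -> : q 0 (lshift 1 l) = lsubmx q 0 l by rewrite mxE.
    rewrite (le_trans (enorm_coord_le _ _))// (le_trans (ltW fq.1))// /C; lra.
  have -> : q 0 (rshift m l) = rsubmx q 0 0 by rewrite mxE ord1.
  by rewrite ler_norml /C; apply/andP; split; lra.
have Sc : compact S.
  apply: bounded_closed_compact => //.
  rewrite /bounded_set /bounded_near; near=> N; move=> q /Sb qC /=.
  by apply: le_trans qC _; near: N; apply: nbhs_pinfty_ge; exact: num_real.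
have [] := EVT_min_rV (f := barrier x) _ Sc.
- by exists q0; exact: fS.
- apply: continuous_in_subspaceT => q /set_mem /Sf; exact: barrier_continuous2.
move=> q /set_mem Sq qmin; exists q; split; first exact: Sf.
move=> q' fq'; have [qM|Mq] := leP (barrier x q') M.
  by apply: qmin; apply/mem_set; exact: fS.
apply: le_trans (ltW Mq); apply: qmin; apply/mem_set; exact: fS.
Unshelve. all: by end_near. Qed.

Lemma is_derive_barrier2 x q w : feasible x q ->
  is_derive q w (barrier x) (dbarrier x q w).
Proof.
move=> f; have n0 := feasible_normal_neq0 ek0 ek1 f.
have := @is_derive_barrier _ _ _ _ v e (x, q) (0, w) n0 f.
rewrite [X in _ - X]big1 ?subr0; last by move=> k _; rewrite /= linear0 dot0l mulr0 mul0r.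
have E : (fun t : R => t^-1 *: (((fun y : X * Q => barrier y.1 y.2) \o shift (x, q)) (t *: (0, w)) - barrier x q)) =
    (fun t : R => t^-1 *: ((barrier x \o shift q) (t *: w) - barrier x q)).
  by apply/funext => t /=; rewrite scaler0 add0r.
by move=> [d D]; split; [move: d | move: D]; rewrite /derivable /derive/= E.
Qed.

Lemma minimizes_dbarrier x q w : minimizes x q -> dbarrier x q w = 0.
Proof.
move=> [f qmin]; have [d <-] := is_derive_barrier2 w f.
have df : differentiable (barrier x) q.
  apply: (@differentiable_comp _ _ _ _ (fun w : Q => (x, w)) (fun y : X * Q => barrier y.1 y.2)).
    exact: differentiable_pair.
  by apply: differentiable_barrier => //; exact: (feasible_normal_neq0 ek0 ek1 f).
rewrite deriveE//; apply: diff_local_min => //.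
by apply: filterS (near_feasible2 f) => y; exact: qmin.
Qed.

(** The optimal plane of a nearby [y] is transported back to [x]: it stays feasible there and is
    nearly optimal, so the growth at [x] forces it close to [g x]. Only the growth constant at [x]
    enters. *)
Lemma minimizer_continuous x (g : X -> Q) :
  (\forall y \near x, minimizes y (g y)) -> {for x, continuous g}.
Proof.
move=> gmin; have gx := nbhs_singleton gmin; have [fx xmin] := gx.
have [c c0 cgrowth] := barrier_growth v ek0 ek1 x.
pose M := barrier x (g x) + 1.
have M0 : 0 < M by rewrite addr_gt0// (barrier_gt0 fx).
have [d [C [d0 C0 stab]]] := barrier_stable (m := m) v e1 M0.
apply/(@cvgrPdist_le _ _ _ _ (nbhs_filter x)) => eps eps0.
(* The bound 1 keeps the value at [y] below [M]; the other is half of the allowed excess c eps^2,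
   the second half going to the transport from [y] to [x]. *)
pose eta := Num.min 1 (c * eps ^+ 2 / 2).
have eta0 : 0 < eta by rewrite lt_min ltr01 divr_gt0// mulr_gt0 ?exprn_gt0.
have h1 : \forall y \near x, feasible y (g x) by exact: near_feasible1.
have h2 : \forall y \near x, barrier y (g x) < barrier x (g x) + eta.
  by apply: (cvgr_lt _ (barrier_continuous1 fx)); rewrite ltrDl.
have h3 : \forall y \near x, `|x - y| <= d by exact: near_dist_le.
have h4 : \forall y \near x, C * `|x - y| <= c * eps ^+ 2 / 2.
  have r0 : 0 < c * eps ^+ 2 / 2 by rewrite divr_gt0// mulr_gt0 ?exprn_gt0.
  have C1 : 0 < C + 1 by rewrite ltr_wpDl.
  have : \forall y \near x, `|x - y| <= c * eps ^+ 2 / 2 / (C + 1).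
    by apply: near_dist_le; rewrite divr_gt0.
  apply: filterS => y; rewrite ler_pdivlMr//; apply: le_trans.
  by rewrite mulrC ler_wpM2l// lerDl.
near=> y.
have ymin : minimizes y (g y) by near: y.
have fy : feasible y (g x) by near: y.
have lt_eta : barrier y (g x) < barrier x (g x) + eta by near: y.
have yd : `|x - y| <= d by near: y.
have yC : C * `|x - y| <= c * eps ^+ 2 / 2 by near: y.
have le1 : barrier y (g y) <= barrier y (g x) by apply: ymin.2.
have le_eta1 : eta <= 1 by rewrite ge_min lexx.
have le_eta2 : eta <= c * eps ^+ 2 / 2 by rewrite ge_min lexx orbT.
have yM : barrier y (g y) <= M by rewrite /M; lra.
have [fxy xy] := stab _ _ _ ymin.1 yM yd.
have := cgrowth _ _ fx fxy; rewrite (minimizes_dbarrier _ gx) subr0 => gr.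
have {}gr : c * dot (g y - g x) (g y - g x) <= c * eps ^+ 2 by lra.
rewrite ler_pM2l// -sqr_enorm in gr.
rewrite distrC (le_trans (normr_le_enorm _))//.
by rewrite -ler_sqr ?nnegrE ?enorm_ge0// ltW.
Unshelve. all: by end_near. Qed.

End Selection.

(** * Differentiability of the optimal plane *)

Section Value.
Context {R : realType} {V m : nat} {K : finType}.
Variables (v : K -> 'I_V) (e : K -> R).
Local Notation X := 'M[R]_(V, m).
Local Notation Q := 'rV[R]_(m + 1).
Implicit Types (x h : X) (q w : Q) (z u : X * Q).
Local Notation slack := (slack v e).
Local Notation barrier := (barrier v e).
Local Notation feasible := (feasible v e).
Local Notation dbarrier := (dbarrier v e).
Local Notation minimizes := (minimizes v e).
Hypothesis e1 : forall k, `|e k| = 1.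
Variables (k0 k1 : K).
Hypotheses (ek0 : e k0 = 1) (ek1 : e k1 = -1).

(** The gradient in the plane variables; its vanishing is the equation that defines the optimal
    plane implicitly. *)
Definition dbarrier_row z : Q := \row_i dbarrier z.1 z.2 (delta_mx 0 i).

Lemma dot_dbarrier_row z w : dot (dbarrier_row z) w = dbarrier z.1 z.2 w.
Proof.
rewrite [in RHS](row_sum_delta w) (big_morph _ (dbarrierD v e z.1 z.2) (_ : _ = 0)).
  by apply: eq_bigr => i _; rewrite mxE dbarrierZ mulrC.
by rewrite -(scale0r (0 : Q)) dbarrierZ mul0r.
Qed.

Lemma minimizer_differentiable x (g : X -> Q) :
  (\forall y \near x, minimizes y (g y)) -> differentiable g x.
Proof.
move=> gmin; have gx := nbhs_singleton gmin; have fx := gx.1.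
have n0 := feasible_normal_neq0 ek0 ek1 fx.
have F0 y : minimizes y (g y) -> dbarrier_row (y, g y) = 0.
  by move=> ymin; apply/rowP => i; rewrite !mxE (minimizes_dbarrier ek0 ek1 _ ymin).
have dF : differentiable dbarrier_row (x, g x).
  apply: differentiable_matrix => i j.
  have -> : (fun z => dbarrier_row z i j) = (fun z => dbarrier z.1 z.2 (delta_mx 0 j)).
    by apply/funext => z; rewrite mxE.
  exact: differentiable_dbarrier.
apply: (implicit_differentiable dF).
- exact: (minimizer_continuous e1 ek0 ek1 gmin).
- by apply: filterS gmin => y; exact: F0.
move=> w dw; apply/eqP; apply: contraT => w0.
(* If [w] were in the kernel of the Hessian, the derivative at [g x + t w] would
   be o(t), whereas adding the growth inequalities between [g x] and [g x + t w]
   in both directions bounds it below by a multiple of t. *)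
have [c c0 growth] := barrier_growth v ek0 ek1 x.
have nw : 0 < enorm w by rewrite enorm_gt0.
pose N : R := (m + 1)%:R.
have N0 : 0 < N by rewrite ltr0n addn1.
(* [N] is the dimension factor lost in [normr_dot_le]; with this [eps] the upper bound on the
   derivative is half of the lower bound c t |w|^2. *)
pose eps := c / (2 * N).
have eps0 : 0 < eps by rewrite divr_gt0// mulr_gt0.
have h1 : \forall t \near (0 : R), feasible x (t *: w + g x).
  exact: (@near0Z _ _ w (fun q => feasible x (q + g x)) (near_addl (near_feasible2 fx))).
have h2 : \forall t \near (0 : R), `|dbarrier_row (x, t *: w + g x)| <= eps * (`|t| * `|w|).
  have := @near0Z _ _ ((0, w) : X * Q) _ (diff_bound dF eps0).
  apply: filterS => t.
  have -> : 'd dbarrier_row (x, g x) (t *: (0, w)) = 0 by rewrite linearZ dw; exact: scaler0.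
  rewrite (F0 _ gx) !subr0.
  rewrite normrZ; congr (`|dbarrier_row _| <= _ * (_ * _)).
    by apply/pair_equal_spec; rewrite /= scaler0 add0r.
  by rewrite prod_normE/= normr0 max_r.
have h12 : \forall t \near (0 : R), feasible x (t *: w + g x) /\
    `|dbarrier_row (x, t *: w + g x)| <= eps * (`|t| * `|w|).
  exact: filterI h1 h2.
have /nbhs_normP[r /= r0 hr] := h12.
pose t := r / 2; have t0 : 0 < t by rewrite divr_gt0.
have [ft Ft] : feasible x (t *: w + g x) /\ `|dbarrier_row (x, t *: w + g x)| <= eps * (`|t| * `|w|).
  by apply: hr; rewrite /= sub0r normrN gtr0_norm// /t; lra.
have := growth _ _ fx ft; have := growth _ _ ft fx.
have -> : g x - (t *: w + g x) = (- t) *: w by rewrite opprD addrCA subrr addr0 scaleNr.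
rewrite addrK (minimizes_dbarrier ek0 ek1 _ gx) subr0 dbarrierZ !dotZl !dotZr => g1 g2.
have := normr_dot_le (dbarrier_row (x, t *: w + g x)) w.
rewrite dot_dbarrier_row/= -/N => /ler_normlP[_] hD.
rewrite (gtr0_norm t0) in Ft.
have hD2 : dbarrier x (t *: w + g x) w <= N * (eps * (t * enorm w)) * enorm w.
  apply: (le_trans hD); rewrite ler_wpM2r ?enorm_ge0// ler_pM2l//.
  apply: (le_trans Ft); rewrite ler_pM2l// ler_pM2l//.
  exact: normr_le_enorm.
have : c * (t * (t * dot w w)) <= t * (N * (eps * (t * enorm w)) * enorm w).
  have : t * dbarrier x (t *: w + g x) w <= t * (N * (eps * (t * enorm w)) * enorm w).
    by rewrite ler_pM2l.
  have : 0 <= c * (- t * (- t * dot w w)).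
    by rewrite !mulNr mulrN opprK !mulr_ge0 ?dot_ge0 ?ltW.
  lra.
have -> : t * (N * (eps * (t * enorm w)) * enorm w) = (c * (t * (t * dot w w))) / 2.
  by rewrite -sqr_enorm /eps; field; rewrite gt_eqF.
have : 0 < c * (t * (t * dot w w)) by rewrite !mulr_gt0// dot_gt0.
lra.
Qed.

End Value.

(** * The minimal value *)

Section ValueFunction.
Context {R : realType} {V m : nat} {K : finType}.
Variables (v : K -> 'I_V) (e : K -> R).
Local Notation X := 'M[R]_(V, m).
Local Notation Q := 'rV[R]_(m + 1).
Implicit Types (x h : X) (q w : Q) (z u : X * Q).
Local Notation slack := (slack v e).
Local Notation barrier := (barrier v e).
Local Notation feasible := (feasible v e).
Local Notation minimizes := (minimizes v e).
Hypothesis e1 : forall k, `|e k| = 1.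
Variables (k0 k1 : K).
Hypotheses (ek0 : e k0 = 1) (ek1 : e k1 = -1).

(* Minus the gradient of [barrier] with respect to [x] for a fixed plane. *)
Definition force z : X :=
  \matrix_(i, j) ((\sum_(k | v k == i) e k / slack k z.1 z.2 ^+ 2) * lsubmx z.2 0 j).

Lemma row_force z i :
  row i (force z) = (\sum_(k | v k == i) e k / slack k z.1 z.2 ^+ 2) *: lsubmx z.2.
Proof. by apply/rowP => j; rewrite !mxE. Qed.

Lemma differentiable_force z : feasible z.1 z.2 -> differentiable force z.
Proof.
move=> [_ s0]; apply: differentiable_matrix => i j.
have -> : (fun y => force y i j) =
    (fun y => \sum_k ((v k == i)%:R * e k) *: (slack k y.1 y.2 * slack k y.1 y.2)^-1)
    * (fun y => lsubmx y.2 0 j).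
  apply/funext => y; rewrite mxE; congr (_ * _).
  rewrite big_mkcond/=; apply: eq_bigr => k _.
  by case: eqP => _; rewrite ?mul1r ?mul0r ?scale0r -?expr2.
apply: differentiableM.
  apply: differentiable_bigsum => k; apply: differentiableZ; apply: differentiableV.
    by apply: differentiableM; exact: differentiable_slack.
  by rewrite mulf_neq0// gt_eqF.
apply: (@differentiable_comp _ _ _ _ (fun y : X * Q => lsubmx y.2) (fun M : 'rV[R]_m => M 0 j)).
  apply: (@differentiable_comp _ _ _ _ (fun y : X * Q => y.2) lsubmx).
    by apply: differentiable_of_linear => // y; exact: cvg_snd.
  exact: differentiable_lsubmx.
exact: differentiable_coord.
Qed.

Lemma value_diff x (g : X -> Q) : (\forall y \near x, minimizes y (g y)) ->
  differentiable (fun y => barrier y (g y)) x /\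
  forall i j, 'd (fun y => barrier y (g y)) x (delta_mx i j) = - force (x, g x) i j.
Proof.
move=> gmin; have gx := nbhs_singleton gmin; have fx := gx.1.
have n0 := feasible_normal_neq0 ek0 ek1 fx.
have dg := minimizer_differentiable e1 ek0 ek1 gmin.
pose f z := barrier z.1 z.2; pose ig y := (y, g y).
have dig : differentiable ig x by exact: differentiable_pair.
have df : differentiable f (ig x) by exact: differentiable_barrier.
split; first exact: (@differentiable_comp _ _ _ _ ig f).
move=> i j; have -> : (fun y => barrier y (g y)) = f \o ig by [].
rewrite diff_comp//=; have -> : 'd ig x (delta_mx i j) = (delta_mx i j, 'd g x (delta_mx i j)).
  rewrite diff_pair//; congr pair.
  by have -> : 'd (fun y : X => y) x = id :> (X -> X) by apply: diff_val.
rewrite -deriveE//.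
have [_ ->] := @is_derive_barrier _ _ _ _ v e (ig x) (delta_mx i j, 'd g x (delta_mx i j)) n0 fx.
(* The motion of the optimal plane enters only through [dbarrier], which vanishes at a minimizer. *)
rewrite (minimizes_dbarrier ek0 ek1 _ gx) sub0r mxE mulr_suml [in RHS]big_mkcond/=; congr (- _).
apply: eq_bigr => k _.
have -> : dot (row (v k) (delta_mx i j)) (lsubmx (g x)) = (v k == i)%:R * lsubmx (g x) 0 j.
  rewrite /dot (bigD1 j)//= big1 => [|l lj]; rewrite !mxE.
    by rewrite eqxx andbT addr0.
  by rewrite (negbTE lj) andbF mul0r.
by case: eqP => _; rewrite ?mul1r ?mul0r ?mulr0 ?mul0r//; ring.
Qed.

(** The plane [q] stays feasible near [x], so minimizers exist there and the default value 0 of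
    [xget] is never returned. *)
Lemma near_minimizes x q : feasible x q ->
  \forall y \near x, minimizes y (xget 0 (minimizes y)).
Proof.
move=> fx; apply: filterS (near_feasible1 fx) => y fy.
have [p py] := feasible_minimizes ek0 ek1 fy.
exact: (xgetI 0 py).
Qed.

End ValueFunction.

Section ExtendedValueFunction.
Context {R : realType} {V : nat} {K : finType}.
Variables (v : K -> 'I_V) (e : K -> R).
Local Notation X := 'M[R]_(V, 3).
Local Notation Q := 'rV[R]_(3 + 1).
Implicit Types (x h : X) (q w : Q) (z u : X * Q).
Local Notation barrier := (barrier v e).
Local Notation feasible := (feasible v e).
Local Notation minimizes := (minimizes v e).
Local Notation force := (force v e).
Hypothesis e1 : forall k, `|e k| = 1.
Variables (k0 k1 : K).
Hypotheses (ek0 : e k0 = 1) (ek1 : e k1 = -1).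
Variable P : X -> \bar R.
Hypothesis P_min : forall x q, minimizes x q -> P x = (barrier x q)%:E.

Lemma value_finite_near x q : feasible x q -> finite_near P x.
Proof.
by move=> /(near_minimizes ek0 ek1); apply: filterS => y /P_min ->.
Qed.

Lemma value_gradient x q : feasible x q ->
  differentiable (real_part P) x /\
  gradient P x = - force (x, xget 0 (minimizes x)).
Proof.
move=> /(near_minimizes ek0 ek1) gmin; have [dp pE] := value_diff e1 ek0 ek1 gmin.
have [|dP PE] := near_eq_is_diff (g := real_part P) _ dp.
  by apply: filterS gmin => y /P_min Py; rewrite /real_part Py.
split=> //; apply/matrixP => i j.
rewrite [LHS]mxE (deriveE _ dP) PE pE; exact/esym/mxE.
Qed.

(** The gradient formula holds at every point near [x], and its right side is [force] along the
    differentiable optimal plane. *)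
Lemma value_twice_differentiable x q : feasible x q -> twice_differentiable P x.
Proof.
move=> fx; have nf := near_feasible1 fx; split; first exact: value_finite_near fx.
  by apply: filterS nf => y /value_gradient[].
have gmin := near_minimizes ek0 ek1 fx.
have dg := minimizer_differentiable e1 ek0 ek1 gmin.
pose g (y : X) : Q := xget 0 (minimizes y).
have dG : differentiable (fun y => - force (y, g y)) x.
  apply: differentiableN; apply: (@differentiable_comp _ _ _ _ (fun y => (y, g y)) force).
    exact: differentiable_pair.
  by apply: differentiable_force; exact: (nbhs_singleton gmin).1.
suff : is_diff x (gradient P) ('d (fun y => - force (y, g y)) x) by case.
apply: near_eq_is_diff dG.
by apply: filterS nf => y /value_gradient[_ ->].
Qed.

End ExtendedValueFunction.

(** * Convex hulls and separation *)

Section Convex.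
Context {R : realType} {n : nat}.
Implicit Types (A B : set 'rV[R]_n) (a b y : 'rV[R]_n).

Lemma convex_setP A : convex_set A <->
  forall t a b, 0 <= t -> t <= 1 -> A a -> A b -> A (t *: a + (1 - t) *: b).
Proof.
split=> [cA t a b t0 t1 /mem_set Aa /mem_set Ab|cA a b l /set_mem Aa /set_mem Ab].
  exact: (set_mem (cA a b (Itv01 t0 t1) Aa Ab)).
by apply/mem_set; apply: cA.
Qed.

(** Weights need not sum to one because stationarity will supply inverse squared slacks. Their
    positivity keeps the partial sums invertible in the induction. *)
Lemma convex_mean A (I : Type) (r : seq I) (w : I -> R) (f : I -> 'rV[R]_n) :
  convex_set A -> (forall i, A (f i)) -> (forall i, 0 < w i) -> r <> [::] ->
  0 < \sum_(i <- r) w i /\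
  A ((\sum_(i <- r) w i)^-1 *: \sum_(i <- r) w i *: f i).
Proof.
move=> /convex_setP cA Af w0; elim: r => [//|i [_ _|j r /(_ _)[//|W0 ih] _]].
  by rewrite !big_seq1 scalerA mulVf ?gt_eqF// scale1r.
rewrite big_cons [\sum_(_ <- i :: _) _ *: _]big_cons.
set W := \sum_(_ <- _) w _ in W0 ih *; set S := \sum_(_ <- _) _ in ih *.
have wW : 0 < w i + W by rewrite addr_gt0.
split=> //; set t := w i / (w i + W).
have -> : (w i + W)^-1 *: (w i *: f i + S) = t *: f i + (1 - t) *: (W^-1 *: S).
  rewrite scalerDr !scalerA /t; congr (_ *: _ + _ *: _); field; rewrite ?gt_eqF//.
apply: cA => //; first by rewrite divr_ge0// ltW.
by rewrite ler_pdivrMr// mul1r lerDl ltW.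
Qed.

Lemma closed_convex_hull_closed A : closed (closed_convex_hull A).
Proof. by apply: closed_bigI => S [[]]. Qed.

Lemma closed_convex_hull_convex A : convex_set (closed_convex_hull A).
Proof.
apply/convex_setP => t a b t0 t1 Aa Ab S SA.
by case: (SA) => -[_ /convex_setP cS _]; apply: cS => //; [exact: Aa|exact: Ab].
Qed.

Lemma continuous_dotl a : continuous (fun y => dot y a).
Proof.
move=> y; apply: differentiable_continuous; apply: differentiable_bigsum => i.
by apply: differentiableM => //; exact: differentiable_coord.
Qed.

Lemma closed_convex_halfspace a (c : R) :
  closed [set y | c <= dot y a] /\ convex_set [set y | c <= dot y a].
Proof.
split.
  apply: (@closed_comp _ _ (fun y => dot y a) [set r | c <= r]) => [y _|].
    exact: continuous_dotl.
  exact: closed_ge.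
apply/convex_setP => t y z t0 t1 /= cy cz; rewrite dotDl !dotZl; nra.
Qed.

Lemma closed_convex_hull_halfspace A a (c : R) :
  (forall y, A y -> c <= dot y a) -> forall y, closed_convex_hull A y -> c <= dot y a.
Proof.
move=> Ac; apply: (@smallest_sub _ _ _ [set y | c <= dot y a]); last exact: Ac.
exact: closed_convex_halfspace.
Qed.

Lemma closed_convex_hull_compact A : bounded_set A -> compact (closed_convex_hull A).
Proof.
move=> bA; apply: bounded_closed_compact; last exact: closed_convex_hull_closed.
have [c [_ hc]] := bA; have {}hc : forall y, A y -> `|y| <= c + 1.
  by move=> y Ay; apply: hc => //; rewrite ltrDl.
exists (c + 1); split; first exact: num_real.
move=> N cN y; apply: (@smallest_sub _ _ _ [set y : 'rV[R]_n | `|y| <= N]).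
  split.
    apply: (@closed_comp _ _ (fun y : 'rV[R]_n => `|y|) [set r | r <= N]) => [z _|].
      exact: norm_continuous.
    exact: closed_le.
  apply/convex_setP => t a b t0 t1 /= aN bN; apply: le_trans (ler_normD _ _) _.
  rewrite !normrZ ger0_norm// ger0_norm ?subr_ge0//; nra.
by move=> z Az /=; apply: le_trans (hc _ Az) (ltW cN).
Qed.

Lemma parabola_slope_ge0 (p q : R) : 0 <= q ->
  (forall t, 0 <= t -> t <= 1 -> 0 <= 2 * t * p + t ^+ 2 * q) -> 0 <= p.
Proof.
move=> q0 h; rewrite leNgt; apply/negP => p0.
have d0 : 0 < q - p by lra.
(* The vertex -p/q of the parabola may be undefined or exceed 1; this smaller step lies in [0, 1]
   and still gives a negative value. *)
have t0 : 0 <= - p / (q - p) by rewrite divr_ge0//; lra.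
have t1 : - p / (q - p) <= 1 by rewrite ler_pdivrMr//; lra.
have := h _ t0 t1.
have -> : 2 * (- p / (q - p)) * p + (- p / (q - p)) ^+ 2 * q =
   - (p ^+ 2 * (q - 2 * p) / (q - p) ^+ 2).
  by field; rewrite gt_eqF.
rewrite leNgt => /negP; apply; rewrite oppr_lt0 divr_gt0 ?exprn_gt0//.
by rewrite mulr_gt0 ?exprn_even_gt0 ?(lt_eqF p0)//; lra.
Qed.

Lemma dot_addZ a b (t : R) : dot (a + t *: b) (a + t *: b) =
  dot a a + 2 * t * dot b a + t ^+ 2 * dot b b.
Proof. by rewrite !(dotDl, dotDr, dotZl, dotZr) (dotC a b); ring. Qed.

(** For a closest pair of points, moving along a segment inside either set cannot shorten the
    distance; to first order this puts the sets on the two sides of the slab orthogonal to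
    [a - b]. *)
Lemma compact_convex_separation A B : compact A -> compact B ->
  convex_set A -> convex_set B -> A !=set0 -> B !=set0 -> A `&` B = set0 ->
  exists w (d : R), [/\ enorm w < 1, forall a, A a -> 0 < dot a w + d &
    forall b, B b -> dot b w + d < 0].
Proof.
move=> cA cB /convex_setP vA /convex_setP vB [a0 Aa0] [b0 Bb0] AB.
pose f (p : 'rV[R]_n * 'rV[R]_n) := dot (p.1 - p.2) (p.1 - p.2).
have [||[a b] /set_mem[/= Aa Bb] fmin] := @compact_EVT_min _ R f _ _ (compact_setX cA cB).
- by exists (a0, b0).
- apply: continuous_subspaceT => p.
  apply: (@continuous_comp _ _ _ (fun p : 'rV[R]_n * 'rV[R]_n => p.1 - p.2) (fun y => dot y y)).
    exact: sub_continuous.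
  apply: differentiable_continuous; apply: differentiable_bigsum => i.
  by apply: differentiableM; exact: differentiable_coord.
pose w := a - b; pose D := dot w w.
have w0 : w != 0.
  rewrite subr_eq0; apply/negP => /eqP ab.
  by have : (A `&` B) a by [split=> //; rewrite ab]; rewrite AB.
have D0 : 0 < D by rewrite dot_gt0.
have Aw a' : A a' -> dot a w <= dot a' w.
  move=> Aa'; rewrite -subr_ge0 -dotBl; apply: (@parabola_slope_ge0 _ (dot (a' - a) (a' - a))).
    exact: dot_ge0.
  move=> t t0 t1; have := fmin (t *: a' + (1 - t) *: a, b).
  rewrite inE => /(_ (conj (vA _ _ _ t0 t1 Aa' Aa) Bb)); rewrite /f/=.
  have -> : t *: a' + (1 - t) *: a - b = w + t *: (a' - a).
    by rewrite scalerBl scale1r scalerBr /w addrCA addrAC.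
  rewrite -/w dot_addZ; lra.
have Bw b' : B b' -> dot b' w <= dot b w.
  move=> Bb'; rewrite -subr_ge0 -dotBl; apply: (@parabola_slope_ge0 _ (dot (b - b') (b - b'))).
    exact: dot_ge0.
  move=> t t0 t1; have := fmin (a, t *: b' + (1 - t) *: b).
  rewrite inE => /(_ (conj Aa (vB _ _ _ t0 t1 Bb' Bb))); rewrite /f/=.
  have -> : a - (t *: b' + (1 - t) *: b) = w + t *: (b - b').
    by rewrite scalerBl scale1r scalerBr /w !opprD opprK addrA addrAC -!addrA; congr (_ + _); rewrite addrCA.
  rewrite -/w dot_addZ; lra.
have abD : dot a w - dot b w = D by rewrite -dotBl.
have nw : 0 < enorm w by rewrite enorm_gt0.
(* Scales the normal to length 1/2, as the norm must be below 1; the plane passes through the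
   midpoint of the closest pair. *)
pose l := (2 * enorm w)^-1; have l0 : 0 < l by rewrite invr_gt0 mulr_gt0.
exists (l *: w), (- l * ((dot a w + dot b w) / 2)); split.
- rewrite enormZ gtr0_norm// /l.
  have -> : (2 * enorm w)^-1 * enorm w = 2^-1 by field; rewrite gt_eqF.
  by rewrite invf_lt1// ltr1n.
- move=> a' /Aw h; rewrite dotZr mulNr -mulrBr mulr_gt0//; lra.
- move=> b' /Bw h; rewrite dotZr mulNr -mulrBr pmulr_rlt0//; lra.
Qed.

End Convex.

(** * The potential of a pair of triangles *)

Section PairPotential.
Context {R : realType} {V T : nat}.
Variables (tri : 'I_T -> 'I_3 -> 'I_V) (i j : 'I_T).
Local Notation X := 'M[R]_(V, 3).
Local Notation Q := 'rV[R]_(3 + 1).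
Implicit Types (x : X) (q : Q) (n : 'rV[R]_3) (d : R).

(** The sum type merges the two sums of the objective into one family of signed points. *)
Definition pair_vertex (k : 'I_3 + 'I_3) : 'I_V :=
  match k with inl a => tri i a | inr a => tri j a end.

Definition pair_sign (k : 'I_3 + 'I_3) : R := if k is inl _ then 1 else -1.

Lemma normr_pair_sign k : `|pair_sign k| = 1.
Proof. by case: k => a; rewrite /= ?normrN normr1. Qed.

Local Notation barrier := (barrier pair_vertex pair_sign).
Local Notation feasible := (feasible pair_vertex pair_sign).
Local Notation slack := (slack pair_vertex pair_sign).
Local Notation minimizes := (minimizes pair_vertex pair_sign).

Let k0 : 'I_3 + 'I_3 := inl 0.
Let k1 : 'I_3 + 'I_3 := inr 0.
Let ek0 : pair_sign k0 = 1. Proof. by []. Qed.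
Let ek1 : pair_sign k1 = -1. Proof. by []. Qed.

Lemma inv_posE (s : R) : inv_pos s = if 0 < s then (s^-1)%:E else +oo%E.
Proof.
rewrite /inv_pos; case: ltP => s0; first by rewrite inver gt_eqF.
by rewrite inve0.
Qed.

Lemma inv_pos_ge0 (s : R) : (0 <= inv_pos s)%E.
Proof. by rewrite inv_posE; case: ltP => s0; rewrite ?leey// lee_fin invr_ge0 ltW. Qed.

Lemma pair_objective_sum x q :
  pair_objective tri i j x (lsubmx q, rsubmx q 0 0) =
  (12%:E * inv_pos (1 - enorm (lsubmx q)) + \sum_k inv_pos (slack k x q))%E.
Proof.
rewrite /pair_objective big_sumType/= addeA; congr (_ + _ + _)%E; apply: eq_bigr => k _.
  by rewrite /slack mul1r.
by rewrite /slack dotNr mulN1r opprD.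
Qed.

Lemma pair_objective_ge0 x p : (0 <= pair_objective tri i j x p)%E.
Proof.
case: p => n d; rewrite /pair_objective !adde_ge0 ?mule_ge0 ?inv_pos_ge0//;
by apply: sume_ge0 => k _; exact: inv_pos_ge0.
Qed.

Lemma pair_objective_feasible x q : feasible x q ->
  pair_objective tri i j x (lsubmx q, rsubmx q 0 0) = (barrier x q)%:E.
Proof.
move=> [n1 s0]; rewrite pair_objective_sum inv_posE subr_gt0 n1.
under eq_bigr do rewrite inv_posE s0.
by rewrite sumEFin -EFinM -EFinD.
Qed.

Lemma pair_objective_infeasible x q : ~ feasible x q ->
  pair_objective tri i j x (lsubmx q, rsubmx q 0 0) = +oo%E.
Proof.
move=> nf; rewrite pair_objective_sum.
have sum0 : (0 <= \sum_k inv_pos (slack k x q))%E.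
  by apply: sume_ge0 => k _; exact: inv_pos_ge0.
have [n1|n1] := ltP (enorm (lsubmx q)) 1; last first.
  by rewrite inv_posE subr_gt0 ltNge n1/= gt0_muley ?lte_fin// addye// gt_eqF// (lt_le_trans _ sum0)// ltNy0.
have [k /negP sk] : exists k, ~ 0 < slack k x q.
  by apply/existsNP => h; apply: nf.
rewrite (bigD1 k)//= [inv_pos (slack k x q)]inv_posE (negbTE sk) addye.
  by rewrite addey// inv_posE subr_gt0 n1.
by rewrite gt_eqF// (lt_le_trans ltNy0)//; apply: sume_ge0 => l _; exact: inv_pos_ge0.
Qed.

Lemma objective_pair n d : exists q, (n, d) = (lsubmx q, rsubmx q 0 0).
Proof.
exists (row_mx n (const_mx d)); rewrite row_mxKl row_mxKr mxE//.
Qed.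

Lemma pair_potential_minimizes x q : minimizes x q ->
  pair_potential tri i j x = (barrier x q)%:E.
Proof.
move=> [fq qmin]; apply/eqP; rewrite eq_le; apply/andP; split.
  by apply: ereal_inf_lbound; exists (lsubmx q, rsubmx q 0 0) => //; exact: pair_objective_feasible.
apply: le_ereal_inf_tmp => _ [[n d] _ <-]; have [q' ->] := objective_pair n d.
have [f'|nf'] := pselect (feasible x q'); last by rewrite pair_objective_infeasible// leey.
by rewrite pair_objective_feasible// lee_fin; exact: qmin.
Qed.

Lemma pair_potential_infeasible x : ~ (exists q, feasible x q) ->
  pair_potential tri i j x = +oo%E.
Proof.
move=> nf; apply/ereal_inf_pinfty => _ [[n d] _ <-]; have [q ->] := objective_pair n d.
by apply: pair_objective_infeasible => f; apply: nf; exists q.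
Qed.

Lemma pair_potential_fin x q : feasible x q -> pair_potential tri i j x \is a fin_num.
Proof.
move=> f; have [p pmin] := feasible_minimizes ek0 ek1 f.
by rewrite (pair_potential_minimizes pmin).
Qed.

Lemma pair_potential_eqy x :
  pair_potential tri i j x = +oo%E <-> ~ (exists q, feasible x q).
Proof.
split; last exact: pair_potential_infeasible.
by move=> E [q /pair_potential_fin]; rewrite E.
Qed.

Lemma pair_potential_ge0 x : (0 <= pair_potential tri i j x)%E.
Proof. by apply: le_ereal_inf_tmp => _ [p _ <-]; exact: pair_objective_ge0. Qed.

Lemma pair_potential_minimum x :
  is_minimum (pair_objective tri i j x) (pair_potential tri i j x).
Proof.
split; last by move=> p; apply: ereal_inf_lbound; exists p.
have [[q f]|nf] := pselect (exists q, feasible x q).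
  have [p pmin] := feasible_minimizes ek0 ek1 f.
  exists (lsubmx p, rsubmx p 0 0); rewrite (pair_potential_minimizes pmin).
  by rewrite pair_objective_feasible//; exact: pmin.1.
(* The objective is identically infinite here, so any plane attains the minimum. *)
exists (lsubmx (0 : Q), rsubmx (0 : Q) 0 0); rewrite pair_potential_infeasible//.
by apply: pair_objective_infeasible => f; apply: nf; exists 0.
Qed.

End PairPotential.

Section Hulls.
Context {R : realType} {V : nat}.
Implicit Types (x : 'M[R]_(V, 3)) (I J : {set 'I_V}).

Lemma CH_row x I i : i \in I -> CH x I (row i x).
Proof. by move=> iI; apply: sub_gen_smallest; exists i. Qed.

Lemma CH_subset x I J : I \subset J -> CH x I `<=` CH x J.
Proof.
move=> /fintype.subsetP IJ; apply: smallest_sub.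
  by split; [exact: closed_convex_hull_closed | exact: closed_convex_hull_convex].
by move=> _ [i /= /IJ iJ <-]; exact: CH_row.
Qed.

Lemma CH_compact x I : compact (CH x I).
Proof.
apply: closed_convex_hull_compact; exists `|x|; split; first exact: num_real.
by move=> N xN _ [i _ <-]; apply: le_trans (normr_row_le i x) (ltW xN).
Qed.

End Hulls.

(** * Collisions and contact forces of a pair of triangles *)

Section PairGeometry.
Context {R : realType} {V T : nat}.
Variables (tri : 'I_T -> 'I_3 -> 'I_V) (i j : 'I_T).
Local Notation X := 'M[R]_(V, 3).
Local Notation Q := 'rV[R]_(3 + 1).
Implicit Types (x : X) (q : Q).
Local Notation pv := (pair_vertex tri i j).
Local Notation pe := (@pair_sign R).
Local Notation feasible := (feasible pv pe).
Local Notation slack := (slack pv pe).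
Local Notation minimizes := (minimizes pv pe).
Let ek0 : pe (inl 0) = 1. Proof. by []. Qed.
Let ek1 : pe (inr 0) = -1. Proof. by []. Qed.

Lemma mem_vset t a : tri t a \in vset tri t.
Proof. exact: imset_f. Qed.

Lemma slack_inl a x q : slack (inl a) x q = dot (row (tri i a) x) (lsubmx q) + rsubmx q 0 0.
Proof. by rewrite /slack mul1r. Qed.

Lemma slack_inr a x q : slack (inr a) x q = - (dot (row (tri j a) x) (lsubmx q) + rsubmx q 0 0).
Proof. by rewrite /slack mulN1r. Qed.

Lemma feasible_disjoint x q : feasible x q ->
  CH x (vset tri i) `&` CH x (vset tri j) = set0.
Proof.
move=> [_ s0]; rewrite -subset0 => y [yi yj].
(* Strict inequalities at the vertices need not survive on a closed hull, so a uniform positive gap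
   is carried over; the two sides then add up to 2c <= 0. *)
pose c := \big[Num.min/1]_k slack k x q.
have c0 : 0 < c by apply: lt_bigmin => // k _; exact: s0.
have cs k : c <= slack k x q by exact: bigmin_le.
have hi : c - rsubmx q 0 0 <= dot y (lsubmx q).
  apply: (closed_convex_hull_halfspace _ yi) => _ [_ /imsetP[a _ ->] <-].
  by have := cs (inl a); rewrite slack_inl lerBlDr.
have hj : c + rsubmx q 0 0 <= dot y (- lsubmx q).
  apply: (closed_convex_hull_halfspace _ yj) => _ [_ /imsetP[a _ ->] <-].
  by have := cs (inr a); rewrite slack_inr dotNr; lra.
rewrite dotNr in hj; lra.
Qed.

Lemma disjoint_feasible x : CH x (vset tri i) `&` CH x (vset tri j) = set0 ->
  exists q, feasible x q.
Proof.
move=> CIJ; have [||w [d [w1 wi wj]]] :=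
    compact_convex_separation (@CH_compact _ _ x (vset tri i)) (@CH_compact _ _ x (vset tri j))
    (@closed_convex_hull_convex _ _ _) (@closed_convex_hull_convex _ _ _) _ _ CIJ.
- by exists (row (tri i 0) x); exact: (CH_row (mem_vset _ _)).
- by exists (row (tri j 0) x); exact: (CH_row (mem_vset _ _)).
exists (row_mx w (const_mx d)); split; first by rewrite row_mxKl.
case=> a; rewrite ?slack_inl ?slack_inr row_mxKl row_mxKr mxE ?oppr_gt0.
- exact: (wi _ (CH_row (mem_vset _ _))).
- exact: (wj _ (CH_row (mem_vset _ _))).
Qed.

Lemma pair_potential_eqyP x : pair_potential tri i j x = +oo%E <->
  CH x (vset tri i) `&` CH x (vset tri j) !=set0.
Proof.
rewrite pair_potential_eqy; split=> [nf|ne [q /feasible_disjoint E]].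
  by apply/set0P/eqP => /disjoint_feasible.
by move: ne; rewrite E => -[].
Qed.

(** Stationarity in [d] equates the total weights [W1] and [W2], so one common factor normalises
    both weighted vertex sums into points of the hulls. *)
Lemma minimizes_normal x q : minimizes x q -> exists b a1 a2,
  [/\ 0 < b, CH x (vset tri i) a1, CH x (vset tri j) a2 & lsubmx q = b *: (a1 - a2)].
Proof.
move=> qmin; have [fq _] := qmin; have [n1 s0] := fq.
have n0 := feasible_normal_neq0 ek0 ek1 fq.
have r0 : 0 < enorm (lsubmx q) by rewrite enorm_gt0.
have dq w : dbarrier pv pe x q w = 0 by exact: (minimizes_dbarrier ek0 ek1).
pose wt k := (slack k x q ^+ 2)^-1.
have wt0 k : 0 < wt k by rewrite invr_gt0 exprn_gt0.
pose W1 := \sum_a wt (inl a); pose W2 := \sum_a wt (inr a).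
pose S1 := \sum_a wt (inl a) *: row (tri i a) x.
pose S2 := \sum_a wt (inr a) *: row (tri j a) x.
have ne3 : index_enum 'I_3 <> [::] by move=> E; have := mem_index_enum (0 : 'I_3); rewrite E.
have [W10 H1] := convex_mean (A := CH x (vset tri i)) (w := fun a => wt (inl a))
  (f := fun a => row (tri i a) x) (@closed_convex_hull_convex _ _ _)
  (fun a => CH_row (mem_vset i a)) (fun a => wt0 _) ne3.
have [_ H2] := convex_mean (A := CH x (vset tri j)) (w := fun a => wt (inr a))
  (f := fun a => row (tri j a) x) (@closed_convex_hull_convex _ _ _)
  (fun a => CH_row (mem_vset j a)) (fun a => wt0 _) ne3.
have W12 : W1 = W2.
  have := dq (row_mx 0 (const_mx 1)).
  rewrite /dbarrier row_mxKl dot0r mulr0 mul0r sub0r big_sumType/=.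
  rewrite (eq_bigr (fun a => wt (inl a))); last first.
    by move=> a _; rewrite slack_inl row_mxKl row_mxKr dot0r mxE add0r mul1r.
  rewrite [X in _ + X](eq_bigr (fun a => - wt (inr a))); last first.
    by move=> a _; rewrite slack_inr row_mxKl row_mxKr dot0r mxE add0r mulN1r.
  rewrite sumrN -/W1 -/W2; lra.
pose c := 12 / (enorm (lsubmx q) * (1 - enorm (lsubmx q)) ^+ 2).
have c0 : 0 < c by rewrite divr_gt0// mulr_gt0// exprn_gt0// subr_gt0.
have nS : c *: lsubmx q = S1 - S2.
  apply: dot_inj => w; have := dq (row_mx w 0).
  rewrite /dbarrier row_mxKl big_sumType/= => /eqP; rewrite subr_eq0 => /eqP E.
  rewrite dotZl /c mulrAC E dotBl !dot_suml -sumrN; congr (_ + _); apply: eq_bigr => a _.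
    by rewrite slack_inl row_mxKl row_mxKr mxE addr0 dotZl mulrC.
  by rewrite slack_inr row_mxKl row_mxKr mxE addr0 dotZl mulNr mulrC.
exists (W1 / c), (W1^-1 *: S1), (W2^-1 *: S2); split=> //; first by rewrite divr_gt0.
rewrite -W12 -scalerBr -nS !scalerA.
have -> : W1 / c / W1 * c = 1 by field; rewrite !gt_eqF.
by rewrite scale1r.
Qed.

Lemma pair_potential_twice_differentiable x q : feasible x q ->
  twice_differentiable (pair_potential tri i j) x.
Proof.
move=> fq; exact: (value_twice_differentiable (@normr_pair_sign R) ek0 ek1
  (@pair_potential_minimizes R V T tri i j) fq).
Qed.

Lemma pair_potential_nonprehensile x q : vset tri i :&: vset tri j = finset.set0 ->
  feasible x q -> nonprehensile_at (vset tri i) (vset tri j) (pair_potential tri i j) x.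
Proof.
move=> dij fq; have Pm := @pair_potential_minimizes R V T tri i j.
have [dP gP] := value_gradient (@normr_pair_sign R) ek0 ek1 Pm fq.
have [p pmin] := feasible_minimizes ek0 ek1 fq.
have gmin : minimizes x (xget 0 (minimizes x)) by exact: (xgetI 0 pmin).
move: gmin gP; set g := xget _ _ => gmin gP.
have [b [a1 [a2 [b0 Ca1 Ca2 nE]]]] := minimizes_normal gmin.
have [_ s0] := gmin.1.
have wt0 k : 0 < (slack k x g ^+ 2)^-1 by rewrite invr_gt0 exprn_gt0.
have disj a a' : (tri i a == tri j a') = false.
  apply/negP => /eqP E; have : tri i a \in vset tri i :&: vset tri j.
    by rewrite finset.inE mem_vset E mem_vset.
  by rewrite dij finset.inE.
split=> //; first exact: (value_finite_near ek0 ek1 Pm fq).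
- move=> l /imsetP[a _ ->]; rewrite gP linearN/= opprK row_force.
  set s := \sum_(k | _) _.
  have s_gt0 : 0 < s.
    (* Several indices may name the same vertex. By disjointness they all belong to the same
       triangle, so their contributions have one sign. *)
    rewrite /s (bigD1 (inl a))//= ltr_wpDr// ?mul1r//.
    apply: sumr_ge0 => -[a'|a'] /andP[/= E _]; first by rewrite mul1r ltW.
    by rewrite eq_sym disj in E.
  by exists (s * b), a1, a2; rewrite mulr_gt0// nE scalerA.
- move=> l /imsetP[a _ ->]; rewrite gP linearN/= opprK row_force.
  set s := \sum_(k | _) _.
  have s_gt0 : 0 < - s.
    rewrite /s -sumrN (bigD1 (inr a))//= ltr_wpDr// ?mulN1r ?opprK//.
    apply: sumr_ge0 => -[a'|a'] /andP[/= E _]; last by rewrite mulN1r opprK ltW.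
    by rewrite disj in E.
  exists (- s * b), a2, a1; rewrite mulr_gt0//; split=> //.
  by rewrite nE scalerA mulNr scaleNr -scalerN opprB.
Qed.

End PairGeometry.

(** * The total potential *)

Section TwiceDifferentiableSum.
Context {R : realType} {V : nat}.
Implicit Types (P Q : 'M[R]_(V, 3) -> \bar R) (x : 'M[R]_(V, 3)).

Lemma twice_differentiable0 x : twice_differentiable (fun=> 0%E : \bar R) x.
Proof.
have E : real_part (fun=> 0%E : \bar R) = cst 0 :> ('M[R]_(V, 3) -> R^o) by [].
split; first by rewrite /finite_near; near=> y.
  by near=> y; rewrite E; exact: differentiable_cst.
have -> : gradient (fun=> 0%E : \bar R) = cst 0 :> ('M[R]_(V, 3) -> _).
  by apply/funext => y; apply/matrixP => i j; rewrite !mxE E derive_cst.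
exact: differentiable_cst.
Unshelve. all: by end_near. Qed.

Lemma twice_differentiableD P Q x : twice_differentiable P x ->
  twice_differentiable Q x -> twice_differentiable (fun y => P y + Q y)%E x.
Proof.
move=> [fP dP ddP] [fQ dQ ddQ].
(* Nested neighbourhoods are needed since the gradient at each [y] near [x] depends on the values
   near that [y]. *)
have fPQ : \forall y \near x, \near y, real_part P y + real_part Q y = real_part (fun y => P y + Q y)%E y.
  apply: near_join; apply: filterS2 fP fQ => y Py Qy.
  by rewrite /real_part fineD.
have h : \forall y \near x, differentiable (real_part (fun y => P y + Q y)%E) y /\
    forall u, 'D_u (real_part P) y + 'D_u (real_part Q) y =
      'D_u (real_part (fun y => P y + Q y)%E) y.
  by apply: filterS3 fPQ dP dQ => y E dPy dQy; exact: near_eq_diffD.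
split.
- by apply: filterS2 fP fQ => y Py Qy; rewrite fin_numD Py.
- by apply: filterS h => y [].
have gE : \forall y \near x,
    gradient P y + gradient Q y = gradient (fun y => P y + Q y)%E y.
  apply: filterS h => y [_ E]; apply/matrixP => i j.
  by rewrite [LHS]mxE [RHS]mxE [gradient P y i j]mxE [gradient Q y i j]mxE E.
exact: (near_eq_diffD gE ddP ddQ).1.
Qed.

Lemma twice_differentiable_sum (I : Type) (r : seq I) (p : pred I)
    (P : I -> 'M[R]_(V, 3) -> \bar R) x :
  (forall i, p i -> twice_differentiable (P i) x) ->
  twice_differentiable (fun y => \sum_(i <- r | p i) P i y)%E x.
Proof.
move=> dP; elim: r => [|i r ih].
  rewrite (_ : (fun y => _) = fun=> 0%E); first exact: twice_differentiable0.
  by apply/funext => y; rewrite big_nil.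
rewrite (_ : (fun y => _) = fun y => if p i then (P i y + \sum_(k <- r | p k) P k y)%E
    else (\sum_(k <- r | p k) P k y)%E); last by apply/funext => y; rewrite big_cons.
by case: (boolP (p i)) => // pi; apply: twice_differentiableD => //; exact: dP.
Qed.

End TwiceDifferentiableSum.

Section PairContinuity.
Context {R : realType} {V T : nat}.
Variables (tri : 'I_T -> 'I_3 -> 'I_V) (i j : 'I_T).
Local Notation X := 'M[R]_(V, 3).
Local Notation pv := (pair_vertex tri i j).
Local Notation pe := (@pair_sign R).
Let ek0 : pe (inl 0) = 1. Proof. by []. Qed.
Let ek1 : pe (inr 0) = -1. Proof. by []. Qed.

(** At an infeasible [x], a nearby configuration of value below [A] would have an optimal plane that
    stability, uniform for values at most [M], makes feasible at [x] too. *)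
Lemma pair_potential_continuous : continuous (pair_potential tri i j : X -> \bar R).
Proof.
move=> x; have [[q fx]|nf] := pselect (exists q, feasible pv pe x q).
  have [fP dP _] := pair_potential_twice_differentiable fx.
  rewrite /continuous_at -[pair_potential tri i j x]fineK; last exact: (pair_potential_fin fx).
  have dx : differentiable (real_part (pair_potential tri i j)) x by exact: nbhs_singleton dP.
  have cx : {for x, continuous (real_part (pair_potential tri i j))}.
    by apply: differentiable_continuous.
  exact: (@cvg_EFin _ _ _ (nbhs_filter x) _ _ fP cx).
rewrite /continuous_at pair_potential_infeasible//; apply/(@cvgeyPge _ _ _ (nbhs_filter x)) => A.
pose M := Num.max A 1; have M0 : 0 < M by rewrite lt_max ltr01 orbT.
have [d [C [d0 _ stab]]] := barrier_stable (m := 3) pv (@normr_pair_sign R) M0.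
apply: filterS (near_dist_le x d0) => y yd.
have [[p fy]|nfy] := pselect (exists q, feasible pv pe y q); last first.
  by rewrite pair_potential_infeasible// leey.
have [q qmin] := feasible_minimizes ek0 ek1 fy.
rewrite (pair_potential_minimizes qmin) lee_fin leNgt; apply/negP => qA.
have qM : barrier pv pe y q <= M by rewrite le_max (ltW qA).
by have [f _] := stab _ _ _ qmin.1 qM yd; apply: nf; exists q.
Qed.

Lemma pair_potential_depends :
  depends_only_on (vset tri i :|: vset tri j) (pair_potential tri i j : X -> \bar R).
Proof.
move=> x y xy; rewrite /pair_potential.
suff -> : pair_objective tri i j x = pair_objective tri i j y by [].
apply/funext => -[n d]; rewrite /pair_objective; congr (_ + _ + _)%E;
by apply: eq_bigr => k _; rewrite xy// finset.inE mem_vset ?orbT.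
Qed.

End PairContinuity.

Section Scene.
Context {R : realType} {V T B : nat}.
Variables (tri : 'I_T -> 'I_3 -> 'I_V) (body : 'I_V -> 'I_B) (C : set 'M[R]_(V, 3)).
Hypothesis tri_body : forall t k l, body (tri t k) = body (tri t l).
Local Notation vs := (vset tri).
Local Notation tb := (tbody tri body).

Lemma body_vset t s : s \in vs t -> body s = tb t.
Proof. by move=> /imsetP[a _ ->]; exact: tri_body. Qed.

Lemma vset_disjoint i j : tb i != tb j -> vs i :&: vs j = finset.set0.
Proof.
move=> ij; apply/setP => s; rewrite !finset.inE; apply/negP => /andP[si sj].
by move: ij; rewrite -(body_vset si) -(body_vset sj) eqxx.
Qed.

Lemma vset_subsetU t i j : vs t \subset vs i :|: vs j ->
  tb i != tb j -> tb t = tb i /\ vs t \subset vs i \/ tb t = tb j /\ vs t \subset vs j.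
Proof.
move=> /fintype.subsetP tij ij.
have [tE|tE] : tb t = tb i \/ tb t = tb j.
  have := tij _ (mem_vset tri t 0); rewrite finset.inE => /orP[] /body_vset <-; by [left|right].
- left; split=> //; apply/fintype.subsetP => s st.
  have := tij _ st; rewrite finset.inE => /orP[//|/body_vset sj].
  by move: ij; rewrite -tE -sj (body_vset st) eqxx.
- right; split=> //; apply/fintype.subsetP => s st.
  have := tij _ st; rewrite finset.inE => /orP[/body_vset si|//].
  by move: ij; rewrite -tE -si (body_vset st) eqxx.
Qed.

(** Other triangles may have their vertices in the union, but each lies on one body, so its hull is
    contained in that of triangle [i] or [j]. *)
Lemma C_obs_onP i j x : C x -> tb i != tb j ->
  C_obs_on tri body C (vs i :|: vs j) x <-> CH x (vs i) `&` CH x (vs j) !=set0.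
Proof.
move=> Cx ij; split=> [[_ [k [l [_ kl]]]]|ne]; last first.
  split=> //; exists i, j; split=> //.
  by apply: contraNneq ij => ->.
rewrite finset.subUset => /andP[/vset_subsetU-/(_ ij) hk /vset_subsetU-/(_ ij) hl].
case: hk hl => -[kE sk] [] [lE sl]; rewrite ?kE ?lE ?eqxx// in kl * => -[y [yk yl]];
  exists y; split; do ?[exact: CH_subset sk _ yk | exact: CH_subset sl _ yl].
Qed.

Let bodies (p : 'I_T * 'I_T) := (p.1 < p.2)%N && (tb p.1 != tb p.2).

Lemma C_free_disjoint x i j : C_free tri body C x -> tb i != tb j ->
  CH x (vs i) `&` CH x (vs j) = set0.
Proof.
move=> [Cx nobs] ij; apply/eqP/negPn/negP => /set0P ne; apply: nobs.
split=> //; exists i, j; split=> //.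
by apply: contraNneq ij => ->.
Qed.

Lemma total_potential_eqy x : C x ->
  total_potential tri body x = +oo%E <-> C_obs tri body C x.
Proof.
move=> Cx.
have P0 (p : 'I_T * 'I_T) : bodies p -> pair_potential tri p.1 p.2 x != -oo%E.
  by move=> _; rewrite gt_eqF// (lt_le_trans ltNy0)// pair_potential_ge0.
rewrite /total_potential (esum_eqyP _ P0); split.
  move=> [p [_ /andP[lt12 b12] /pair_potential_eqyP ne]]; split=> //.
  exists p.1, p.2; split=> //.
  by apply: contraNneq b12 => ->.
move=> [_ [k [l [kl bkl ne]]]].
(* The total lists each unordered pair once, so the colliding pair may appear there with its
   triangles swapped. *)
have [lt|gt|/val_inj E] := ltngtP k l; last by rewrite E eqxx in kl.
- exists (k, l); rewrite mem_index_enum /bodies/= lt bkl; split=> //.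
  exact/pair_potential_eqyP.
- exists (l, k); rewrite mem_index_enum /bodies/= gt eq_sym bkl; split=> //.
  by apply/pair_potential_eqyP; rewrite setIC.
Qed.

End Scene.

Theorem lemma4p1 (R : realType) (V T B : nat)
    (tri : 'I_T -> 'I_3 -> 'I_V) (body : 'I_V -> 'I_B)
    (C : set 'M[R]_(V, 3))
    (tri_body : forall t k l, body (tri t k) = body (tri t l))
    (C_rigid : moves_rigidly body C) :
  (forall i j : 'I_T, tbody tri body i != tbody tri body j ->
     [/\ forall x : 'M[R]_(V, 3),
           is_minimum (pair_objective tri i j x) (pair_potential tri i j x),
         pairwise_log_barrier tri body C (vset tri i) (vset tri j)
           (pair_potential tri i j),
         pairwise_smooth tri body C (vset tri i) (vset tri j)
           (pair_potential tri i j) &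
         pairwise_nonprehensile C (vset tri i) (vset tri j)
           (pair_potential tri i j)]) /\
  [/\ log_barrier tri body C (total_potential tri body),
      smooth tri body C (total_potential tri body) &
      nonprehensile_nonvanishing tri body C
        (fun p : 'I_T * 'I_T => vset tri p.1)
        (fun p : 'I_T * 'I_T => vset tri p.2)
        (fun p : 'I_T * 'I_T => pair_potential tri p.1 p.2)
        (total_potential tri body)].
Proof.
have nonpre i j (x : 'M[R]_(V, 3)) : tbody tri body i != tbody tri body j ->
    CH x (vset tri i) `&` CH x (vset tri j) = set0 ->
    nonprehensile_at (vset tri i) (vset tri j) (pair_potential tri i j) x.
  move=> ij /disjoint_feasible[q fq].
  exact: (pair_potential_nonprehensile (vset_disjoint tri_body ij) fq).
split=> [i j ij|]; split.
- exact: pair_potential_minimum.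
- split=> [x _|x Cx]; first exact: pair_potential_ge0.
  by rewrite (C_obs_onP tri_body Cx ij); exact: pair_potential_eqyP.
- move=> x [Cx nobs].
  have [q fq] : exists q, feasible (pair_vertex tri i j) (@pair_sign R) x q.
    apply/disjoint_feasible/eqP/negPn/negP => /set0P ne.
    by apply: nobs; exact/(C_obs_onP tri_body Cx ij).
  exact: (pair_potential_twice_differentiable fq).
- by move=> x Cx; exact: nonpre.
- split.
  + by move=> x _; apply: sume_ge0 => p _; exact: pair_potential_ge0.
  + apply: continuous_subspaceT => x; apply: (@cvg_nnesum _ _ (nbhs_pfilter x)) => p _.
      by apply: nearW => y; exact: pair_potential_ge0.
    exact: pair_potential_continuous.
  + by move=> x Cx; exact: total_potential_eqy.
- move=> x fx; apply: twice_differentiable_sum => p /andP[_ p12].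
  have [q fq] := disjoint_feasible (C_free_disjoint fx p12).
  exact: (pair_potential_twice_differentiable fq).
- move=> x fx.
  (* The same family serves at every free configuration: all the summands of the total potential. *)
  exists [set p : 'I_T * 'I_T | (p.1 < p.2)%N && (tbody tri body p.1 != tbody tri body p.2)]%SET.
  split.
  + move=> p; rewrite finset.inE => /andP[_ p12].
    have dis := C_free_disjoint fx p12.
    split=> //; [exact: vset_disjoint p12 | exact: pair_potential_depends | exact: nonpre].
  + by move=> y; apply: eq_bigl => p; rewrite finset.inE.
  + move=> i j ij; have [lt|gt|/val_inj E] := ltngtP i j; last by rewrite E eqxx in ij.
    * by exists (i, j); rewrite // finset.inE/= lt ij.
    * by exists (j, i); rewrite /= 1?finset.setUC // finset.inE/= gt eq_sym ij.
Qed.
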